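(* The variety of complex $3$-dimensional associative superalgebras of type $(1,2)$ has dimension $4$ and has exactly $12$ irreducible components: $\overline{\mathcal{O}(\mathrm{R}_{04}^{\alpha})},\ \overline{\mathcal{O}(\mathrm{R}_{06}^{\alpha})},\ \overline{\mathcal{O}(\mathrm{R}_{09})},\ \overline{\mathcal{O}(\mathrm{R}_{11})},\ \overline{\mathcal{O}(\mathrm{R}_{13})},\ \overline{\mathcal{O}(\mathrm{R}_{15})},\ \overline{\mathcal{O}(\mathrm{R}_{18})},\ \overline{\mathcal{O}(\mathrm{R}_{19})},\ \overline{\mathcal{O}(\mathrm{R}_{20})},\ \overline{\mathcal{O}(\mathrm{R}_{22})},\ \overline{\mathcal{O}(\mathrm{R}_{23})},\ \overline{\mathcal{O}(\mathrm{R}_{24})}$. In particular, exactly $10$ superalgebras are rigid in this variety.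
   Context: All algebras are over $\mathbb{C}$. A superalgebra is a $\mathbb{Z}_2$-graded algebra $A=A_0\oplus A_1$ with $A_iA_j\subseteq A_{i+j \bmod 2}$; $|x|\in\{0,1\}$ is the degree of a homogeneous $x$. It has type $(n,m)$ if $\dim A_0=n$, $\dim A_1=m$. The associator is $(x,y,z)=(xy)z-x(yz)$; a superalgebra is associative if $(x,y,z)=0$ for all $x,y,z$. Geometric setting: fix a graded space $V=V_0\oplus V_1$ of type $(n,m)$ with a homogeneous basis. Superalgebra structures on $V$ are even bilinear maps $\mu:V\times V\to V$, identified with their structure constants; those satisfying a given family of graded polynomial identities form a Zariski-closed subset (an affine variety) of this affine space. The group $GL(V_0)\times GL(V_1)$ acts by $(g*\mu)(x,y)=g\mu(g^{-1}x,g^{-1}y)$; its orbits are the isomorphism classes. $\mathcal{O}(A)$ denotes the orbit of (a structure representing) $A$ and $\overline{\mathcal{O}(A)}$ its Zariski closure; for a family $A^{\alpha}$, $\overline{\mathcal{O}(A^{\alpha})}$ denotes the closure of the union of the orbits of all $A^{\alpha}$ over the admissible parameters $\alpha$. A superalgebra is rigid if its orbit is open in the variety. The dimension of the variety is the maximal dimension of its irreducible components. Superalgebras of type $(1,2)$, in basis $e_1$ (even), $f_1,f_2$ (odd), listed by nonzero products (unlisted products are zero), $\alpha\in\mathbb{C}$: $\mathrm{R}_{04}^{\alpha}$: $f_1f_2=(\alpha+1)e_1,\ f_2f_1=(\alpha-1)e_1$; $\mathrm{R}_{06}^{\alpha}$: $e_1f_1=(1+\alpha)f_2,\ f_1e_1=(1-\alpha)f_2$;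 $\mathrm{R}_{09}$: $e_1e_1=e_1,\ f_1e_1=f_1$; $\mathrm{R}_{11}$: $e_1e_1=e_1,\ e_1f_1=f_1$; $\mathrm{R}_{13}$: $e_1e_1=e_1,\ e_1f_1=f_1,\ e_1f_2=f_2,\ f_1e_1=f_1$; $\mathrm{R}_{15}$: $e_1e_1=e_1,\ e_1f_1=f_1,\ f_1e_1=f_1,\ f_2e_1=f_2$; $\mathrm{R}_{18}$: $e_1e_1=e_1,\ e_1f_1=f_1,\ f_1e_1=f_1,\ f_1f_1=e_1$; $\mathrm{R}_{19}$: $e_1e_1=e_1$; $\mathrm{R}_{20}$: $e_1e_1=e_1,\ e_1f_1=f_1,\ f_2e_1=f_2$; $\mathrm{R}_{22}$: $e_1e_1=e_1,\ f_1e_1=f_1,\ f_2e_1=f_2$; $\mathrm{R}_{23}$: $e_1e_1=e_1,\ e_1f_1=f_1,\ e_1f_2=f_2$; $\mathrm{R}_{24}$: $e_1e_1=e_1,\ e_1f_1=f_1,\ f_1e_1=f_1,\ e_1f_2=f_2,\ f_2e_1=f_2$. *)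

(* Defs.v *)
From HB Require Import structures.
From mathcomp Require Import all_boot all_algebra.
From mathcomp Require Import complex.
From mathcomp Require Import Rstruct.
From mathcomp Require Import mpoly.
Set Implicit Arguments. Unset Strict Implicit. Unset Printing Implicit Defensive.
Import GRing.Theory.
Local Open Scope ring_scope.

Definition CC : Type := complex.complex Rdefinitions.R.

Definition zclosed (T : finType) (S : (T -> CC) -> Prop) : Prop :=
  exists P : {mpoly CC[#|T|]} -> Prop,
    forall x : T -> CC, S x <-> (forall p, P p -> p.@[fun i => x (enum_val i)] = 0).

Definition subset_of (T : Type) (A B : T -> Prop) := forall x, A x -> B x.
Definition seteq (T : Type) (A B : T -> Prop) := forall x, A x <-> B x.

Definition zclosure (T : finType) (S : (T -> CC) -> Prop) : (T -> CC) -> Prop :=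
  fun x => forall Z, zclosed Z -> subset_of S Z -> Z x.

Definition irreducible (T : finType) (Z : (T -> CC) -> Prop) : Prop :=
  [/\ zclosed Z, exists x, Z x &
      forall Z1 Z2, zclosed Z1 -> zclosed Z2 ->
        subset_of Z (fun x => Z1 x \/ Z2 x) -> subset_of Z Z1 \/ subset_of Z Z2].

Definition irr_component (T : finType) (X Z : (T -> CC) -> Prop) : Prop :=
  [/\ irreducible Z, subset_of Z X &
      forall W, irreducible W -> subset_of Z W -> subset_of W X -> seteq W Z].

Definition has_chain (T : finType) (Y : (T -> CC) -> Prop) (n : nat) : Prop :=
  exists Z : nat -> (T -> CC) -> Prop,
    (forall i, (i <= n)%N -> irreducible (Z i) /\ subset_of (Z i) Y) /\
    (forall i, (i < n)%N -> subset_of (Z i) (Z i.+1) /\ ~ subset_of (Z i.+1) (Z i)).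

Definition krull_dim (T : finType) (Y : (T -> CC) -> Prop) (n : nat) : Prop :=
  has_chain Y n /\ ~ has_chain Y n.+1.

Definition variety_dim (T : finType) (X : (T -> CC) -> Prop) (n : nat) : Prop :=
  (exists Z, irr_component X Z /\ krull_dim Z n) /\
  (forall Z m, irr_component X Z -> krull_dim Z m -> (m <= n)%N).

(* ---------- Superalgebra structures of type (1,2) on V = <e1> + <f1, f2>.
   Basis index 0 = e1 (even), 1 = f1, 2 = f2 (odd).  A structure is given by
   its structure constants: c (i, j, k) = coefficient of b_k in b_i b_j. *)
Definition idx := ('I_3 * 'I_3 * 'I_3)%type.
Definition struct := idx -> CC.

Definition sdeg (i : 'I_3) : bool := (i != 0 :> nat).

Definition smul (c : struct) (x y : 'I_3 -> CC) : 'I_3 -> CC :=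
  fun k => \sum_(i < 3) \sum_(j < 3) x i * y j * c (i, j, k).

Definition even_struct (c : struct) : Prop :=
  forall i j k : 'I_3, sdeg k != (sdeg i (+) sdeg j) -> c (i, j, k) = 0.

Definition assoc_struct (c : struct) : Prop :=
  forall x y z : 'I_3 -> CC, forall k,
    smul c (smul c x y) z k = smul c x (smul c y z) k.

Definition AssocVar : struct -> Prop := fun c => even_struct c /\ assoc_struct c.

Definition graded_GL (g : 'M[CC]_3) : Prop :=
  g \in unitmx /\ forall i j : 'I_3, sdeg i != sdeg j -> g i j = 0.

(* (g * mu)(x, y) = g mu(g^-1 x, g^-1 y) *)
Definition act (g : 'M[CC]_3) (c : struct) : struct :=
  fun t => let: (i, j, k) := t in
    \sum_(p < 3) \sum_(q < 3) \sum_(r < 3)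
      invmx g p i * invmx g q j * c (p, q, r) * g k r.

Definition sorbit (c : struct) : struct -> Prop :=
  fun d => exists g, graded_GL g /\ d = act g c.

Definition rigid_in (X : struct -> Prop) (c : struct) : Prop :=
  X c /\ exists F, zclosed F /\ forall d, sorbit c d <-> (X d /\ ~ F d).

(* structure from a list of nonzero products b_i b_j = v b_k, given as (i,j,k,v) *)
Definition mk (l : seq (nat * nat * nat * CC)) : struct :=
  fun t => \sum_(u <- l | [&& u.1.1.1 == t.1.1 :> nat, u.1.1.2 == t.1.2 :> nat
                            & u.1.2 == t.2 :> nat]) u.2.

Definition ent (i j k : nat) (v : CC) : nat * nat * nat * CC := (i, j, k, v).
Arguments ent (i j k)%_N v%_R.

Definition R04 (a : CC) := mk [:: ent 1 2 0 (a + 1); ent 2 1 0 (a - 1)].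
Definition R06 (a : CC) := mk [:: ent 0 1 2 (1 + a); ent 1 0 2 (1 - a)].
Definition R09 := mk [:: ent 0 0 0 (1); ent 1 0 1 (1)].
Definition R11 := mk [:: ent 0 0 0 (1); ent 0 1 1 (1)].
Definition R13 := mk [:: ent 0 0 0 (1); ent 0 1 1 (1); ent 0 2 2 (1); ent 1 0 1 (1)].
Definition R15 := mk [:: ent 0 0 0 (1); ent 0 1 1 (1); ent 1 0 1 (1); ent 2 0 2 (1)].
Definition R18 := mk [:: ent 0 0 0 (1); ent 0 1 1 (1); ent 1 0 1 (1); ent 1 1 0 (1)].
Definition R19 := mk [:: ent 0 0 0 (1)].
Definition R20 := mk [:: ent 0 0 0 (1); ent 0 1 1 (1); ent 2 0 2 (1)].
Definition R22 := mk [:: ent 0 0 0 (1); ent 1 0 1 (1); ent 2 0 2 (1)].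
Definition R23 := mk [:: ent 0 0 0 (1); ent 0 1 1 (1); ent 0 2 2 (1)].
Definition R24 := mk [:: ent 0 0 0 (1); ent 0 1 1 (1); ent 1 0 1 (1);
                         ent 0 2 2 (1); ent 2 0 2 (1)].

Definition orbit_cl (c : struct) : struct -> Prop := zclosure (sorbit c).
Definition family_orbit_cl (F : CC -> struct) : struct -> Prop :=
  zclosure (fun d => exists a : CC, sorbit (F a) d).

Definition listed_components : seq (struct -> Prop) :=
  [:: family_orbit_cl R04; family_orbit_cl R06; orbit_cl R09; orbit_cl R11;
      orbit_cl R13; orbit_cl R15; orbit_cl R18; orbit_cl R19; orbit_cl R20;
      orbit_cl R22; orbit_cl R23; orbit_cl R24].

Definition comp_of (i : 'I_12) : struct -> Prop :=
  nth (fun _ => False) listed_components i.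

(* Main.v *)
Require Import Defs.
From HB Require Import structures.
From mathcomp Require Import all_boot all_algebra.
From mathcomp Require Import complex Rstruct mpoly.
From mathcomp Require Import boolp ring.
Set Implicit Arguments. Unset Strict Implicit. Unset Printing Implicit Defensive.
Import GRing.Theory Num.Theory.
Local Open Scope ring_scope.

(* An even structure is a tuple (a, L, R, B): e1 e1 = a e1, the operators L and R of left
   and right multiplication by e1 on the odd part, and the form B with f f' = B(f, f') e1.
   - Associativity forces one of three shapes: a = L = R = 0 with B arbitrary; a = B = 0 with
     L, R proportional to one nilpotent matrix; or a = v(u) for a vector u and a covector v,
     L and R being combinations of a I and the rank one matrix u v with coefficients in
     {0, 1, -1} (the Peirce decomposition when a is nonzero) and B = b v v, where b = 0
     unless L = R = u v.  Each shape is the image of A^4 under a polynomial map.  This gives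
     twelve irreducible closed sets, which are the closures of the orbits of the listed
     algebras.
   - No inclusion holds between two of them: when a is nonzero, tr L / a, tr R / a and
     tr LR / a^2 identify the set, and a, the skew part of B and the off-diagonal entries of
     L and R settle the other cases.
   - Dimension: in a chain of irreducible closed sets choose at each step a polynomial
     vanishing on the smaller set only.  The monomials in these n polynomials are linearly
     independent on the largest set, whereas n > 4 polynomials in 4 variables have linearly
     dependent monomials, by counting those of bounded degree.
   - The ten algebras with a = 1 are rigid, since their orbits are complements in the variety
     of the other components, of a = 0 and (for R18) of B = 0.  A rigid orbit inside a
     component meets the dense union of listed orbits; in the two families an open orbit would
     contain members with different isomorphism invariants. *)

(** * Zariski topology and polynomial maps *)

Section ZariskiTopology.
Variable T : finType.
Implicit Types (S Z : (T -> CC) -> Prop) (p q : {mpoly CC[#|T|]}).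

Definition ev (x : T -> CC) p : CC := p.@[fun i => x (enum_val i)].

HB.instance Definition _ x := GRing.RMorphism.copy (ev x) (meval (fun i => x (enum_val i))).

Lemma evZ x a p : ev x (a *: p) = a * ev x p.
Proof. exact: mevalZ. Qed.

Definition polyfun (f : (T -> CC) -> CC) : Prop := exists p, forall x, f x = ev x p.

Lemma polyfun_ev p : polyfun (fun x => ev x p).
Proof. by exists p. Qed.

Lemma polyfun_const a : polyfun (fun=> a).
Proof. by exists a%:MP => x; rewrite /ev mevalC. Qed.

Lemma polyfun_coord t : polyfun (fun x => x t).
Proof. by exists 'X_(enum_rank t) => x; rewrite /ev mevalXU enum_rankK. Qed.

Lemma polyfunD f g : polyfun f -> polyfun g -> polyfun (fun x => f x + g x).
Proof. by move=> [p Ep] [q Eq]; exists (p + q) => x; rewrite rmorphD /= -Ep -Eq. Qed.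

Lemma polyfunM f g : polyfun f -> polyfun g -> polyfun (fun x => f x * g x).
Proof. by move=> [p Ep] [q Eq]; exists (p * q) => x; rewrite rmorphM /= -Ep -Eq. Qed.

Lemma polyfunN f : polyfun f -> polyfun (fun x => - f x).
Proof. by move=> [p Ep]; exists (- p) => x; rewrite rmorphN /= -Ep. Qed.

Lemma polyfunB f g : polyfun f -> polyfun g -> polyfun (fun x => f x - g x).
Proof. by move=> Pf Pg; apply: polyfunD => //; apply: polyfunN. Qed.

Lemma polyfunX f n : polyfun f -> polyfun (fun x => f x ^+ n).
Proof. by move=> [p Ep]; exists (p ^+ n) => x; rewrite rmorphXn /= -Ep. Qed.

Lemma polyfun_sum (I : Type) (r : seq I) (f : I -> (T -> CC) -> CC) :
  (forall i, polyfun (f i)) -> polyfun (fun x => \sum_(i <- r) f i x).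
Proof.
move=> Pf; elim: r => [|i r [p Ep]].
  by exists 0 => x; rewrite rmorph0 big_nil.
have [q Eq] := Pf i.
by exists (q + p) => x; rewrite big_cons rmorphD /= -Eq -Ep.
Qed.

Lemma polyfun_prod (I : Type) (r : seq I) (f : I -> (T -> CC) -> CC) :
  (forall i, polyfun (f i)) -> polyfun (fun x => \prod_(i <- r) f i x).
Proof.
move=> Pf; elim: r => [|i r [p Ep]].
  by exists 1 => x; rewrite rmorph1 big_nil.
have [q Eq] := Pf i.
by exists (q * p) => x; rewrite big_cons rmorphM /= -Eq -Ep.
Qed.

Lemma zclosedE S : zclosed S ->
  exists P : {mpoly CC[#|T|]} -> Prop, forall x, S x <-> forall p, P p -> ev x p = 0.
Proof. by []. Qed.

Lemma zclosed_zeros (I : Type) (f : I -> (T -> CC) -> CC) :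
  (forall i, polyfun (f i)) -> zclosed (fun x => forall i, f i x = 0).
Proof.
move=> Pf; exists (fun p => exists i, forall x, f i x = ev x p) => x; split.
  by move=> fx0 p [i Ep]; rewrite -[LHS]/(ev x p) -Ep.
by move=> H i; have [p Ep] := Pf i; rewrite Ep; apply: H; exists i.
Qed.

Lemma zclosed_zero f : polyfun f -> zclosed (fun x => f x = 0).
Proof.
move=> Pf; have [P HP] := @zclosed_zeros unit (fun=> f) (fun=> Pf).
by exists P => x; rewrite -HP; split => // /(_ tt).
Qed.

Lemma zclosed_seteq S Z : seteq S Z -> zclosed S -> zclosed Z.
Proof. by move=> SZ [P HP]; exists P => x; rewrite -SZ. Qed.

Lemma zclosed_union S Z : zclosed S -> zclosed Z -> zclosed (fun x => S x \/ Z x).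
Proof.
move=> /zclosedE[P HP] /zclosedE[Q HQ].
exists (fun r => exists p q, [/\ P p, Q q & r = p * q]) => x; split.
  move=> SZx _ [p [q [Pp Qq ->]]].
  rewrite -[LHS]/(ev x _) rmorphM /=.
  case: SZx => [/HP|/HQ] H0; first by rewrite H0 // mul0r.
  by rewrite (H0 q) // mulr0.
move=> H0; case: (EM (S x)) => Sx; [by left | right].
move: Sx; rewrite HP -existsNP => -[p /not_implyP[Pp /eqP px]].
apply/HQ => q Qq; have := H0 _ (ex_intro _ p (ex_intro _ q (And3 Pp Qq erefl))).
by rewrite -[LHS]/(ev x _) rmorphM /= => /eqP; rewrite mulf_eq0 (negPf px) => /eqP.
Qed.

Lemma zclosed_inter (I : Type) (S : I -> (T -> CC) -> Prop) :
  (forall i, zclosed (S i)) -> zclosed (fun x => forall i, S i x).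
Proof.
move=> clS; have [P HP] := choice (fun i => zclosedE (clS i)).
exists (fun p => exists i, P i p) => x; split.
  by move=> Sx p [i Pip]; apply: (proj1 (HP i x)) Pip.
by move=> H i; apply/HP => p Pp; apply: H; exists i.
Qed.

Lemma zclosed_bigunion (n : nat) (S : nat -> (T -> CC) -> Prop) :
  (forall i, zclosed (S i)) -> zclosed (fun x => exists2 i, (i < n)%N & S i x).
Proof.
move=> clS; elim: n => [|n IHn].
  apply: (@zclosed_seteq (fun=> 1 = 0 :> CC)); last exact/zclosed_zero/polyfun_const.
  by move=> x; split; [move/eqP; rewrite oner_eq0 | case].
apply: zclosed_seteq (zclosed_union IHn (clS n)) => x; split.
  by case=> [[i lt_in Sx]|Sx]; [exists i => //; apply: ltnW | exists n].
case=> i +; rewrite ltnS leq_eqVlt => /predU1P[->|lt_in] Sx; first by right.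
by left; exists i.
Qed.

Lemma sub_zclosure S : subset_of S (zclosure S).
Proof. by move=> x Sx Z _; apply. Qed.

Lemma zclosure_min S Z : zclosed Z -> subset_of S Z -> subset_of (zclosure S) Z.
Proof. by move=> clZ SZ x; apply. Qed.

Lemma mem_zclosure S x :
  zclosure S x <-> forall p, (forall y, S y -> ev y p = 0) -> ev x p = 0.
Proof.
split=> [Sx p Sp0|H Z /zclosedE[P HP] SZ].
  by apply: Sx Sp0; apply/zclosed_zero/polyfun_ev.
by apply/HP => p Pp; apply: H => y /SZ /HP; apply.
Qed.

Lemma zclosed_zclosure S : zclosed (zclosure S).
Proof.
by exists (fun p => forall y, S y -> ev y p = 0) => x; rewrite mem_zclosure.
Qed.

Lemma zclosure_sub S S' : subset_of S (zclosure S') -> subset_of (zclosure S) (zclosure S').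
Proof. by move=> SS'; apply: zclosure_min => //; apply: zclosed_zclosure. Qed.

Lemma zclosed_notin Z x : zclosed Z -> ~ Z x ->
  exists p, (forall y, Z y -> ev y p = 0) /\ ev x p != 0.
Proof.
move=> /zclosedE[P HP]; rewrite HP -existsNP => -[p /not_implyP[Pp /eqP px]].
by exists p; split=> // y /HP; apply.
Qed.

Lemma irreducible_seteq S Z : seteq S Z -> irreducible S -> irreducible Z.
Proof.
move=> SZ [clS [x Sx] irrS]; split; first exact: zclosed_seteq clS.
  by exists x; apply/SZ.
move=> Z1 Z2 cl1 cl2 Z12.
case: (irrS Z1 Z2 cl1 cl2) => [y /SZ /Z12 //|H|H]; [left|right] => y /SZ; exact: H.
Qed.

Lemma irreducible_mul Z p q : irreducible Z ->
    (forall x, Z x -> ev x p * ev x q = 0) ->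
  (forall x, Z x -> ev x p = 0) \/ (forall x, Z x -> ev x q = 0).
Proof.
move=> [_ _ irrZ] pq0.
apply: (irrZ (fun x => ev x p = 0) (fun x => ev x q = 0)).
- exact/zclosed_zero/polyfun_ev.
- exact/zclosed_zero/polyfun_ev.
by move=> x /pq0 /eqP; rewrite mulf_eq0 => /orP[] /eqP; [left|right].
Qed.

Lemma irreducible_bigunion Z (n : nat) (S : nat -> (T -> CC) -> Prop) :
    irreducible Z -> (forall i, zclosed (S i)) ->
    subset_of Z (fun x => exists2 i, (i < n)%N & S i x) ->
  exists2 i, (i < n)%N & subset_of Z (S i).
Proof.
move=> [_ [x Zx] irrZ] clS; elim: n => [ZS|n IHn ZS]; first by case: (ZS x Zx).
case: (irrZ _ _ (zclosed_bigunion n clS) (clS n)) => [y /ZS|/IHn [i lt_in ZSi]|ZSn].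
- case=> i +; rewrite ltnS leq_eqVlt => /predU1P[->|lt_in] Sy; first by right.
  by left; exists i.
- by exists i => //; apply: ltnW.
by exists n.
Qed.

End ZariskiTopology.

Lemma polyfun_comp (S T : finType) (f : (T -> CC) -> CC) (F : (S -> CC) -> T -> CC) :
  polyfun f -> (forall t, polyfun (fun s => F s t)) -> polyfun (fun s => f (F s)).
Proof.
move=> [p Ep] PF.
suff [q Eq] : polyfun (fun s => ev (F s) p) by exists q => s; rewrite Ep.
rewrite (_ : (fun s => _) = fun s =>
  \sum_(m <- msupp p) p@_m * \prod_i F s (enum_val i) ^+ m i); last first.
  by apply: funext => s; rewrite /ev mevalE.
apply: polyfun_sum => m; apply: polyfunM; first exact: polyfun_const.
by apply: polyfun_prod => i; apply: polyfunX.
Qed.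

Lemma polyfun_curve (T : finType) (f : (T -> CC) -> CC) (c : T -> {poly CC}) :
  polyfun f -> exists q : {poly CC}, forall e, f (fun t => (c t).[e]) = q.[e].
Proof.
move=> [p Ep]; exists (\sum_(m <- msupp p) p@_m *: \prod_i c (enum_val i) ^+ m i).
move=> e; rewrite Ep /ev mevalE horner_sum; apply: eq_bigr => m _.
rewrite hornerZ horner_prod; congr (_ * _).
by apply: eq_bigr => i _; rewrite horner_exp.
Qed.

Lemma poly_nonroot (q : {poly CC}) : q != 0 -> exists e, q.[e] != 0.
Proof.
move=> q0; apply: contrapT; rewrite -forallNP => H.
(* In characteristic 0 these are [size q] distinct points, one more than the degree of [q]. *)
pose rs : seq CC := [seq i%:R | i <- iota 0 (size q)].
have: (size rs < size q)%N.
  apply: max_poly_roots => //.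
    by apply/allP => e _; apply: contraT => /(H e).
  rewrite map_inj_uniq ?iota_uniq // => i j /eqP.
  by rewrite eqr_nat => /eqP.
by rewrite size_map size_iota ltnn.
Qed.

(** Affine space is irreducible: restricted to the line through [x] and [y], both functions become
    nonzero univariate polynomials, and their product has a nonroot. *)
Lemma polyfun_meet (T : finType) (f g : (T -> CC) -> CC) (x y : T -> CC) :
  polyfun f -> polyfun g -> f x != 0 -> g y != 0 -> exists z, f z != 0 /\ g z != 0.
Proof.
move=> Pf Pg fx gy.
pose c t : {poly CC} := (x t)%:P + (y t - x t)%:P * 'X.
have [p Ep] := polyfun_curve c Pf; have [q Eq] := polyfun_curve c Pg.
have c0 : (fun t => (c t).[0]) = x.
  by apply: funext => t; rewrite !hornerE.
have c1 : (fun t => (c t).[1]) = y.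
  apply: funext => t; rewrite hornerD hornerM !hornerC hornerX; ring.
have pq0 : p * q != 0.
  rewrite mulf_neq0 //.
    by apply: contraNneq fx => p0; rewrite -c0 Ep p0 horner0.
  by apply: contraNneq gy => q0; rewrite -c1 Eq q0 horner0.
have [e] := poly_nonroot pq0; rewrite hornerM mulf_eq0 negb_or -Ep -Eq => /andP[].
by exists (fun t => (c t).[e]).
Qed.

(** A polynomial vanishing on [S] pulls back to a univariate polynomial that is zero off the
    finitely many roots of [d], hence zero. This gives membership of limit points. *)
Lemma zclosure_curve (T : finType) (S : (T -> CC) -> Prop) (c : T -> {poly CC}) (d : {poly CC}) :
    d != 0 -> (forall e, d.[e] != 0 -> zclosure S (fun t => (c t).[e])) ->
  forall e, zclosure S (fun t => (c t).[e]).
Proof.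
move=> d0 Sc e0; apply/mem_zclosure => p Sp0.
have [q Eq] := polyfun_curve c (polyfun_ev p).
suff q0 : q = 0 by rewrite Eq q0 horner0.
apply/eqP; apply: contraT => qn0.
have [e] := poly_nonroot (mulf_neq0 d0 qn0).
rewrite hornerM mulf_eq0 negb_or => /andP[/Sc /mem_zclosure Sce].
by rewrite -Eq Sce ?eqxx.
Qed.

Section PolynomialMaps.
Variables (S T : finType) (F : (S -> CC) -> T -> CC).
Hypothesis polyF : forall t, polyfun (fun s => F s t).

Definition image_of : (T -> CC) -> Prop := fun x => exists s, x = F s.

(** If neither of two covering closed sets contained the image, two polynomials would have nonzero
    pullbacks that are never nonzero at the same parameter, against [polyfun_meet]. *)
Lemma irreducible_image : irreducible (zclosure image_of).
Proof.
split; first exact: zclosed_zclosure.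
  by exists (F (fun=> 0)); apply: sub_zclosure; exists (fun=> 0).
move=> Z1 Z2 cl1 cl2 Z12; apply: contrapT; rewrite not_orP => -[N1 N2].
have out Z : zclosed Z -> ~ subset_of (zclosure image_of) Z ->
    exists p s, (forall y, Z y -> ev y p = 0) /\ ev (F s) p != 0.
  move=> clZ NZ; apply: contrapT => H; apply: NZ; apply: zclosure_min => // _ [s ->].
  apply: contrapT => /(zclosed_notin clZ)[p [Zp ps]].
  by apply: H; exists p, s.
have [p [s [Zp ps]]] := out _ cl1 N1; have [q [t [Zq qt]]] := out _ cl2 N2.
have [z [pz qz]] := polyfun_meet (polyfun_comp (polyfun_ev p) polyF)
  (polyfun_comp (polyfun_ev q) polyF) ps qt.
have [|/Zp/eqP|/Zq/eqP] := Z12 (F z); first by apply: sub_zclosure; exists z.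
  by rewrite (negPf pz).
by rewrite (negPf qz).
Qed.

(** The set [d != 0] is dense in the parameter space, so its image is dense in the whole image. *)
Lemma dense_image (A : (T -> CC) -> Prop) (d : (S -> CC) -> CC) s0 :
    polyfun d -> d s0 != 0 -> (forall s, d s != 0 -> A (F s)) ->
  subset_of image_of (zclosure A).
Proof.
move=> Pd ds0 AF _ [s ->]; apply/mem_zclosure => p Ap.
apply/eqP; apply: contraT => ps.
have [z [/AF/Ap dz /eqP]] := polyfun_meet Pd (polyfun_comp (polyfun_ev p) polyF) ds0 ps.
by rewrite dz.
Qed.

End PolynomialMaps.

(** * Dimension of images of polynomial maps *)

Section LinearIndependence.
Variable T : finType.
Implicit Types (S Z : (T -> CC) -> Prop).

(** Independence of the restrictions to [S] as functions, not of the polynomials themselves. *)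
Definition lin_indep S (I : finType) (p : I -> {mpoly CC[#|T|]}) : Prop :=
  forall c : I -> CC, (forall x, S x -> \sum_i c i * ev x (p i) = 0) -> forall i, c i = 0.

Lemma lin_indep_subset S Z (I : finType) (p : I -> {mpoly CC[#|T|]}) :
  subset_of S Z -> lin_indep S p -> lin_indep Z p.
Proof. by move=> SZ indS c Hc; apply: indS => x /SZ; apply: Hc. Qed.

(** A relation is a polynomial in [h] with coefficients in the span of [F]. On the irreducible [Z']
    it may be divided by powers of [h]; restricting to [Z], where [h] vanishes, isolates the lowest
    coefficient, which is zero by independence on [Z]. *)
Lemma lin_indep_extend Z Z' (I : finType) (F : I -> {mpoly CC[#|T|]}) D h :
    irreducible Z' -> subset_of Z Z' -> lin_indep Z F ->
    (forall x, Z x -> ev x h = 0) -> ~ (forall x, Z' x -> ev x h = 0) ->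
  lin_indep Z' (fun i : 'I_D * I => h ^+ i.1 * F i.2).
Proof.
move=> irrZ' ZZ' indF hZ hZ' c c0.
suff H (n : nat) : forall j : 'I_D, j = n :> nat -> forall i, c (j, i) = 0.
  by case=> j i; apply: H erefl i.
elim/ltn_ind: n => n IHn j jn.
(* The relation divided by [h ^+ n], its terms of index below [n] being already zero. *)
pose Q := \sum_(k < D | (n <= k)%N) h ^+ (k - n) * \sum_i c (k, i) *: F i.
have evQ x : ev x Q =
    \sum_(k < D | (n <= k)%N) ev x h ^+ (k - n) * \sum_i c (k, i) * ev x (F i).
  rewrite /Q rmorph_sum; apply: eq_bigr => k _ /=; rewrite rmorphM rmorphXn /= rmorph_sum.
  by congr (_ * _); apply: eq_bigr => i _; rewrite /= evZ.
have hQ x : Z' x -> ev x (h ^+ n) * ev x Q = 0.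
  move=> Z'x; rewrite evQ rmorphXn /= mulr_sumr -[RHS](c0 x Z'x).
  rewrite (eq_bigr (fun i => c (i.1, i.2) * ev x (h ^+ (i.1, i.2).1 * F (i.1, i.2).2)));
    last by case.
  rewrite -(pair_bigA _ (fun k i => c (k, i) * ev x (h ^+ k * F i))) /=.
  rewrite [RHS](bigID (fun k : 'I_D => (n <= k)%N)) /= [X in _ + X]big1 ?addr0.
    apply: eq_bigr => k nk; rewrite mulrA -exprD subnKC // mulr_sumr.
    by apply: eq_bigr => i _; rewrite rmorphM rmorphXn /= mulrCA.
  move=> k; rewrite -ltnNge => kn; rewrite big1 // => i _.
  by rewrite (IHn k kn k erefl) mul0r.
have [hn0|Q0] := irreducible_mul irrZ' hQ.
  by case: hZ' => x /hn0 /eqP; rewrite rmorphXn /= expf_eq0 => /andP[_ /eqP].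
move=> i; apply: (indF (fun i => c (j, i))) => x Zx.
(* On [Z] only the term [k = n] of [Q] survives. *)
have := Q0 x (ZZ' x Zx).
rewrite evQ (bigD1 j) ?jn //= subnn expr0 mul1r [X in _ + X]big1 ?addr0 //.
move=> k /andP[nk kj]; rewrite hZ // expr0n subn_eq0 leqNgt.
have -> : (n < k)%N by rewrite ltn_neqAle nk andbT -jn eq_sym.
by rewrite mul0r.
Qed.

(** Exponent vectors with all entries below [D], nested as pairs so that adding one polynomial is
    one use of [lin_indep_extend]. *)
Fixpoint mon_idx (D : nat) (s : seq {mpoly CC[#|T|]}) : finType :=
  if s is _ :: s' then ('I_D * mon_idx D s')%type : finType else unit.

Fixpoint monomial D s : mon_idx D s -> {mpoly CC[#|T|]} :=
  if s is h :: s' then fun i => h ^+ i.1 * monomial i.2 else fun=> 1.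

Lemma card_mon_idx D s : #|mon_idx D s| = (D ^ size s)%N.
Proof. by elim: s => [|h s IHs] /=; rewrite ?card_unit // card_prod card_ord IHs expnS. Qed.

(** Each strict inclusion supplies a polynomial vanishing on the smaller set only. The list is fixed
    before [D], because [D] is later chosen from the degrees of its members. *)
Lemma chain_lin_indep Y k : has_chain Y k ->
  exists2 s, size s = k & forall D, lin_indep Y (@monomial D s).
Proof.
move=> [Z [irrZ ltZ]].
have ZY : subset_of (Z k) Y by have [] := irrZ k (leqnn k).
suff [s sz_s indZ] : exists2 s, size s = k & forall D, lin_indep (Z k) (@monomial D s).
  by exists s => // D; apply: lin_indep_subset (indZ D).
elim: k {ZY} irrZ ltZ => [|k IHk] irrZ ltZ.
  exists [::] => // D c; have [[_ [x Zx] _] _] := irrZ 0%N isT.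
  move=> /(_ x Zx) + []; rewrite (big_pred1 tt); last by case.
  by rewrite /= rmorph1 mulr1.
have [||s sz_s indZ] := IHk.
- by move=> i ik; apply: irrZ; apply: leqW.
- by move=> i ik; apply: ltZ; apply: leqW.
have [irrk _] := irrZ k.+1 (leqnn _); have [[clk _ _] _] := irrZ k (leqnSn k).
have [sub nsub] := ltZ k (leqnn _).
have [x /not_implyP[Zx NZx]] : exists x, ~ (Z k.+1 x -> Z k x) by apply/existsNP.
have [h [hZ hx]] := zclosed_notin clk NZx.
exists (h :: s) => [|D]; first by rewrite /= sz_s.
apply: lin_indep_extend sub (indZ D) hZ _ => //.
by move=> /(_ x Zx) /eqP; rewrite (negPf hx).
Qed.

End LinearIndependence.

Lemma card_bmultinom n N : (#|{: 'X_{1..n < N}}| <= N ^ n)%N.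
Proof.
have mnm_le_mdeg (m : 'X_{1..n}) i : (m i <= mdeg m)%N.
  by rewrite mdegE (bigD1 i) //= leq_addr.
pose f (m : 'X_{1..n < N}) : {ffun 'I_n -> 'I_N} :=
  [ffun i => Ordinal (leq_ltn_trans (mnm_le_mdeg m i) (bmdeg m))].
rewrite -[X in (_ <= X ^ _)%N](card_ord N) -[X in (_ <= _ ^ X)%N](card_ord n) -card_ffun.
apply: (@leq_card _ _ f) => m m' /ffunP mm'; apply/val_inj/mnmP => i.
by have := mm' i; rewrite !ffunE => -[].
Qed.

(** There are more polynomials than monomials available to them, so the matrix of coefficients has a
    nonzero left kernel. *)
Lemma mpoly_dependent n N (I : finType) (p : I -> {mpoly CC[n]}) :
    (forall i, msize (p i) <= N)%N -> (N ^ n < #|I|)%N ->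
  exists c : I -> CC, (exists i, c i != 0) /\ \sum_i c i *: p i = 0.
Proof.
move=> pN ltI; pose J : finType := 'X_{1..n < N}.
pose A : 'M[CC]_(#|I|, #|J|) := \matrix_(i, j) (p (enum_val i))@_(enum_val j : J).
have /rowV0Pn[v /sub_kermxP vA v0] : kermx A != 0.
  rewrite kermx_eq0 /row_free; apply: contraTneq (rank_leq_col A) => ->.
  by rewrite -ltnNge (leq_ltn_trans (card_bmultinom n N)).
exists (fun i => v 0 (enum_rank i)); split.
  by have [i vi] := rV0Pn _ v0; exists (enum_val i); rewrite enum_valK.
under eq_bigr => i _ do rewrite (mpolywE (pN i)) scaler_sumr.
rewrite exchange_big big1 //= => m _.
under eq_bigr => i _ do rewrite scalerA.
rewrite -scaler_suml.
suff -> : \sum_i v 0 (enum_rank i) * (p i)@_m = 0 by rewrite scale0r.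
have /matrixP/(_ 0 (enum_rank (m : J))) := vA.
rewrite !mxE => vA0; rewrite -[RHS]vA0.
rewrite (reindex (@enum_val _ I)) /=; last exact/onW_bij/enum_val_bij.
by apply: eq_bigr => i _; rewrite mxE enum_rankK enum_valK.
Qed.

(** [msize] is the degree plus one, and 0 for the zero polynomial, so a bound [1 + a] reads as
    degree at most [a]. *)
Lemma msizeM_le n (p q : {mpoly CC[n]}) a b :
  (msize p <= 1 + a)%N -> (msize q <= 1 + b)%N -> (msize (p * q) <= 1 + (a + b))%N.
Proof.
have [->|p0] := eqVneq p 0; first by rewrite mul0r msize0.
have [->|q0] := eqVneq q 0; first by rewrite mulr0 msize0.
rewrite msizeM // => pa qb; rewrite -subn1 leq_subLR addnA.
by rewrite (leq_trans (leq_add pa qb)) // addnACA.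
Qed.

Lemma msizeX_le n (p : {mpoly CC[n]}) a k :
  (msize p <= 1 + a)%N -> (msize (p ^+ k) <= 1 + k * a)%N.
Proof.
move=> pa; elim: k => [|k IHk]; first by rewrite expr0 msize1.
by rewrite exprS mulSn; apply: msizeM_le.
Qed.

Section PolynomialMapDimension.
Variables (S T : finType) (F : (S -> CC) -> T -> CC).
Hypothesis polyF : forall t, polyfun (fun s => F s t).

(** The degrees grow only linearly in [D]: the constant [d], fixed before [D], bounds the degrees of
    the pullbacks of the members of [s]. *)
Lemma monomial_pullback (s : seq {mpoly CC[#|T|]}) : exists d, forall D,
  exists g : mon_idx D s -> {mpoly CC[#|S|]}, forall i,
    (forall x, ev (F x) (monomial i) = ev x (g i)) /\
    (msize (g i) <= 1 + size s * (D * d))%N.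
Proof.
elim: s => [|h s [d IHd]].
  exists 0%N => D; exists (fun=> 1) => i; split; last by rewrite msize1.
  by move=> x; rewrite !rmorph1.
have [p Ep] := polyfun_comp (polyfun_ev h) polyF.
exists (maxn d (msize p)) => D; have [g Hg] := IHd D.
exists (fun i : 'I_D * mon_idx D s => p ^+ i.1 * g i.2) => -[j i] /=.
have [Eg sz_g] := Hg i; split=> [x|].
  by rewrite !rmorphM !rmorphXn /= Ep Eg.
rewrite mulSn; apply: msizeM_le.
  apply: leq_trans (msizeX_le (a := msize p) j _) _; first exact: leqW.
  by rewrite leq_add2l leq_mul ?leq_maxr // ltnW.
by apply: leq_trans sz_g _; rewrite leq_add2l !leq_mul ?leq_maxl.
Qed.

(** A chain of length [n] gives [D ^ n] independent functions on the image. Their pullbacks have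
    degree linear in [D] in [#|S|] variables, a space of dimension at most of order [D ^ #|S|],
    which is too small for large [D]. *)
Lemma image_no_chain (n : nat) : (#|S| < n)%N -> ~ has_chain (zclosure (image_of F)) n.
Proof.
move=> ltSn /chain_lin_indep[s sz_s ind_s].
have [d Hd] := monomial_pullback s.
(* With [m = #|S|], this choice gives [(1 + n * D * d) ^ m <= (1 + n * d) ^ m * D ^ m < D ^ m.+1 <=
   D ^ n]. *)
pose D := ((1 + n * d) ^ #|S|).+1; have [g Hg] := Hd D.
have [||c [[i ci] c0]] := @mpoly_dependent #|S| (1 + n * (D * d)) _ g.
- by move=> i; have [] := Hg i; rewrite sz_s.
- rewrite card_mon_idx sz_s; apply: (@leq_trans (D ^ #|S|.+1)%N); last exact: leq_pexp2l.
  rewrite expnS; apply: (@leq_ltn_trans (((1 + n * d) * D) ^ #|S|)%N); last first.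
    by rewrite expnMn ltn_pmul2r // expn_gt0.
  have [->|S0] := posnP #|S|; first by rewrite !expn0.
  by rewrite leq_exp2r // mulnDl mul1n [(D * d)%N]mulnC mulnA leq_add2r.
suff c_eq0 : forall i, c i = 0 by rewrite c_eq0 eqxx in ci.
apply: (ind_s D) => x Zx.
(* The relation between pullbacks makes [p] vanish on the image, hence on its closure. *)
pose p := \sum_i c i *: @monomial T D s i.
have evp y : ev y p = \sum_i c i * ev y (monomial i).
  by rewrite /p rmorph_sum; apply: eq_bigr => j _; rewrite /= evZ.
rewrite -evp; apply/(proj1 (mem_zclosure _ _) Zx) => _ [y ->].
rewrite evp -[RHS](rmorph0 (ev y)) -c0 rmorph_sum; apply: eq_bigr => j _.
by have [-> _] := Hg j; rewrite /= evZ.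
Qed.

End PolynomialMapDimension.

(** * Structures of type (1,2) and the group action *)

(** This lets [ring] use an equation: the goal holds if its two sides differ by the same amount as
    those of a known equality. *)
Lemma eq_modulo (x y x' y' : CC) : x = y -> x' - y' = x - y -> x' = y'.
Proof. by move=> -> /eqP; rewrite subrr subr_eq0 => /eqP. Qed.

Ltac ring_from E := (apply: (eq_modulo E); ring) || (apply: (eq_modulo (esym E)); ring).

(** Indexing the odd basis by [bool] makes entries compute under case analysis, so that matrix
    identities become goals for [ring] and [field]. *)
Definition mat := bool -> bool -> CC.
Implicit Types (L R B M : mat) (u v : bool -> CC).

Definition mmul M L : mat := fun i j => M i false * L false j + M i true * L true j.
Definition mdet M : CC := M false false * M true true - M false true * M true false.
Definition minv M : mat := fun i j =>
  (if i == j then M (~~ i) (~~ j) else - M i j) / mdet M.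
Definition outer u v : mat := fun i j => u i * v j.
Definition scal (a : CC) : mat := fun i j => a * (i == j)%:R.
Definition dot u v : CC := u false * v false + u true * v true.

(* [None] stands for e1, [Some false] for f1 and [Some true] for f2. *)
Definition bidx (x : option bool) : 'I_3 :=
  match x with None => @Ordinal 3 0 isT | Some false => @Ordinal 3 1 isT
             | Some true => @Ordinal 3 2 isT end.

Lemma bidxP (i : 'I_3) : exists x, i = bidx x.
Proof.
case: i => [[|[|[|//]]] lti].
- by exists None; apply: val_inj.
- by exists (Some false); apply: val_inj.
- by exists (Some true); apply: val_inj.
Qed.

Lemma sum_bidx (V : nmodType) (f : 'I_3 -> V) :
  \sum_i f i = f (bidx None) + (f (bidx (Some false)) + f (bidx (Some true))).
Proof.
rewrite !big_ord_recl big_ord0 addr0.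
by congr (f _ + (f _ + f _)); apply: val_inj.
Qed.

(* The even structure with e1 e1 = a e1, e1 f_j = \sum_k L k j f_k,
   f_j e1 = \sum_k R k j f_k and f_i f_j = B i j e1. *)
Definition alg (a : CC) L R B : struct := fun t =>
  match nat_of_ord t.1.1, nat_of_ord t.1.2, nat_of_ord t.2 with
  | 0, 0, 0 => a
  | 0, j.+1, k.+1 => L (odd k) (odd j)
  | i.+1, 0, k.+1 => R (odd k) (odd i)
  | i.+1, j.+1, 0 => B (odd i) (odd j)
  | _, _, _ => 0
  end.

Lemma algE a L R B x y z : alg a L R B (bidx x, bidx y, bidx z) =
  match x, y, z with
  | None, None, None => a
  | None, Some j, Some k => L k j
  | Some i, None, Some k => R k i
  | Some i, Some j, None => B i j
  | _, _, _ => 0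
  end.
Proof. by case: x => [[]|]; case: y => [[]|]; case: z => [[]|]. Qed.

Lemma struct_eqP (c d : struct) :
  (forall x y z, c (bidx x, bidx y, bidx z) = d (bidx x, bidx y, bidx z)) -> c = d.
Proof.
move=> cd; apply: funext => -[[i j] k].
by have [x ->] := bidxP i; have [y ->] := bidxP j; have [z ->] := bidxP k.
Qed.

Lemma alg_inj a L R B a' L' R' B' : alg a L R B = alg a' L' R' B' ->
  [/\ a = a', L = L', R = R' & B = B'].
Proof.
move=> E.
have H x y z : alg a L R B (bidx x, bidx y, bidx z) = alg a' L' R' B' (bidx x, bidx y, bidx z).
  by rewrite E.
split; first by have := H None None None; rewrite !algE.
- apply: funext => k; apply: funext => j.
  by have := H None (Some j) (Some k); rewrite !algE.
- apply: funext => k; apply: funext => j.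
  by have := H (Some j) None (Some k); rewrite !algE.
- apply: funext => k; apply: funext => j.
  by have := H (Some k) (Some j) None; rewrite !algE.
Qed.

Lemma matP L R : (forall i j, L i j = R i j) -> L = R.
Proof. by move=> LR; apply: funext => i; apply: funext => j. Qed.

Lemma even_alg a L R B : even_struct (alg a L R B).
Proof.
move=> i j k; have [x ->] := bidxP i; have [y ->] := bidxP j; have [z ->] := bidxP k.
by rewrite algE; case: x => [[]|]; case: y => [[]|]; case: z => [[]|].
Qed.

Lemma evenE (c : struct) : even_struct c -> c = alg
  (c (bidx None, bidx None, bidx None))
  (fun k j => c (bidx None, bidx (Some j), bidx (Some k)))
  (fun k i => c (bidx (Some i), bidx None, bidx (Some k)))
  (fun i j => c (bidx (Some i), bidx (Some j), bidx None)).
Proof.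
move=> ev_c; apply: struct_eqP => x y z; rewrite algE.
by case: x => [[]|]; case: y => [[]|]; case: z => [[]|] //; apply: ev_c.
Qed.

Lemma assoc_basisP (c : struct) : assoc_struct c <-> forall i j k l,
  \sum_r c (i, j, r) * c (r, k, l) = \sum_r c (j, k, r) * c (i, r, l).
Proof.
have lhsE x y z l : smul c (smul c x y) z l =
    \sum_i \sum_j \sum_k x i * y j * z k * \sum_r c (i, j, r) * c (r, k, l).
  rewrite /smul !sum_bidx; ring.
have rhsE x y z l : smul c x (smul c y z) l =
    \sum_i \sum_j \sum_k x i * y j * z k * \sum_r c (j, k, r) * c (i, r, l).
  rewrite /smul !sum_bidx; ring.
split=> [assoc_c i j k l | H x y z l]; last first.
  rewrite lhsE rhsE; apply: eq_bigr => i _; apply: eq_bigr => j _.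
  by apply: eq_bigr => k _; rewrite H.
pose b (i j : 'I_3) : CC := (j == i)%:R.
have bE h (f : 'I_3 -> CC) : \sum_j b h j * f j = f h.
  rewrite (bigD1 h) //= big1 ?addr0 /b ?eqxx ?mul1r // => m /negPf ->.
  by rewrite mul0r.
have cub (f : 'I_3 -> 'I_3 -> 'I_3 -> CC) :
    \sum_i' \sum_j' \sum_k' b i i' * b j j' * b k k' * f i' j' k' = f i j k.
  rewrite -[RHS](bE i (fun i => f i j k)); apply: eq_bigr => i' _.
  rewrite -[f i' j k](bE j (fun j => f i' j k)) mulr_sumr; apply: eq_bigr => j' _.
  rewrite -[f i' j' k](bE k (fun k => f i' j' k)) !mulr_sumr; apply: eq_bigr => k' _.
  by rewrite !mulrA.
have := assoc_c (b i) (b j) (b k) l.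
by rewrite lhsE rhsE !cub.
Qed.

(** Associativity on basis triples, one field for each placement of the odd arguments. The triple of
    three copies of e1 gives a trivial identity. *)
Record assoc_data (a : CC) L R B : Prop := AssocData {
  adLL : forall i j, mmul L L i j = a * L i j;
  adRR : forall i j, mmul R R i j = a * R i j;
  adLR : forall i j, mmul L R i j = mmul R L i j;
  adLB : forall i j, L false i * B false j + L true i * B true j = a * B i j;
  adBR : forall i j, B i false * R false j + B i true * R true j = a * B i j;
  adRBL : forall i j,
    R false i * B false j + R true i * B true j = B i false * L false j + B i true * L true j;
  adBLR : forall i j k l, B i j * L l k = B j k * R l i }.

Lemma assoc_algP a L R B : AssocVar (alg a L R B) <-> assoc_data a L R B.
Proof.
split=> [[_ /assoc_basisP H]|H].
  have {}H x y z t := H (bidx x) (bidx y) (bidx z) (bidx t).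
  split.
  - by move=> i j; have := H None None (Some j) (Some i);
      rewrite !sum_bidx !algE /mmul => E; ring_from E.
  - by move=> i j; have := H (Some j) None None (Some i);
      rewrite !sum_bidx !algE /mmul => E; ring_from E.
  - by move=> i j; have := H None (Some j) None (Some i);
      rewrite !sum_bidx !algE /mmul => E; ring_from E.
  - by move=> i j; have := H None (Some i) (Some j) None;
      rewrite !sum_bidx !algE /mmul => E; ring_from E.
  - by move=> i j; have := H (Some i) (Some j) None None;
      rewrite !sum_bidx !algE /mmul => E; ring_from E.
  - by move=> i j; have := H (Some i) None (Some j) None;
      rewrite !sum_bidx !algE /mmul => E; ring_from E.
  - by move=> i j k l; have := H (Some i) (Some j) (Some k) (Some l);
      rewrite !sum_bidx !algE /mmul => E; ring_from E.
split; first exact: even_alg.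
apply/assoc_basisP => i j k l.
have [x ->] := bidxP i; have [y ->] := bidxP j; have [z ->] := bidxP k; have [t ->] := bidxP l.
case: H => LL RR LR LB BR RBL BLR.
rewrite !sum_bidx !algE.
case: x => [x|]; case: y => [y|]; case: z => [z|]; case: t => [t|]; try ring.
- by have := BLR x y z t; rewrite /mmul => E; ring_from E.
- by have := BR x y; rewrite /mmul => E; ring_from E.
- by have := RBL x z; rewrite /mmul => E; ring_from E.
- by have := RR t x; rewrite /mmul => E; ring_from E.
- by have := LB y z; rewrite /mmul => E; ring_from E.
- by have := LR t y; rewrite /mmul => E; ring_from E.
- by have := LL t z; rewrite /mmul => E; ring_from E.
Qed.

Lemma zclosed_AssocVar : zclosed AssocVar.
Proof.
apply: (@zclosed_seteq _ (fun c => forall b : bool,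
    if b then even_struct c else forall w : 'I_3 * 'I_3 * 'I_3 * 'I_3,
      \sum_r c (w.1.1.1, w.1.1.2, r) * c (r, w.1.2, w.2) -
      \sum_r c (w.1.1.2, w.1.2, r) * c (w.1.1.1, r, w.2) = 0)).
  move=> c; split=> [H|[ev_c /assoc_basisP H] [] //].
    split; first exact: (H true).
    apply/assoc_basisP => i j k l; apply/eqP; rewrite -subr_eq0; apply/eqP.
    exact: (H false (i, j, k, l)).
  by move=> [[[i j] k] l] /=; rewrite H subrr.
apply: zclosed_inter => -[].
  apply: (@zclosed_seteq _ (fun c => forall w : {w : idx | sdeg w.2 != (sdeg w.1.1 (+) sdeg w.1.2)},
    c (sval w) = 0)).
    move=> c; split=> [H i j k ijk|H [[[i j] k] ijk]]; last exact: H.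
    exact: (H (exist _ (i, j, k) ijk)).
  by apply: zclosed_zeros => w; apply: polyfun_coord.
apply: zclosed_zeros => w; apply: polyfunB; apply: polyfun_sum => r;
  by apply: polyfunM; apply: polyfun_coord.
Qed.

Definition gmx (s : CC) M : 'M[CC]_3 :=
  \matrix_(i, j) match nat_of_ord i, nat_of_ord j with
  | 0, 0 => s
  | i'.+1, j'.+1 => M (odd i') (odd j')
  | _, _ => 0
  end.

Lemma gmxE s M x y : gmx s M (bidx x) (bidx y) =
  match x, y with None, None => s | Some i, Some j => M i j | _, _ => 0 end.
Proof. by rewrite mxE; case: x => [[]|]; case: y => [[]|]. Qed.

Lemma mx3P (g h : 'M[CC]_3) : (forall x y, g (bidx x) (bidx y) = h (bidx x) (bidx y)) -> g = h.
Proof.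
move=> gh; apply/matrixP => i j.
by have [x ->] := bidxP i; have [y ->] := bidxP j.
Qed.

Lemma gmx_mulV s M : s != 0 -> mdet M != 0 -> gmx s M *m gmx s^-1 (minv M) = 1%:M.
Proof.
move=> s0 M0; apply: mx3P => x y; rewrite !mxE sum_bidx !gmxE /minv.
case: x => [[]|]; case: y => [[]|]; rewrite /= ?mulr0 ?mul0r ?addr0 //; first 1 last.
all: try by rewrite mulfV.
all: by move: M0; rewrite /mdet => M0; field.
Qed.

Lemma graded_GL_gmx g : graded_GL g <-> exists s M, [/\ s != 0, mdet M != 0 & g = gmx s M].
Proof.
split=> [[g_unit g0]|[s [M [s0 M0 ->]]]]; last first.
  split; first by have [] := mulmx1_unit (gmx_mulV s0 M0).
  move=> i j; have [x ->] := bidxP i; have [y ->] := bidxP j.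
  by rewrite gmxE; case: x => [[]|]; case: y => [[]|].
pose s := g (bidx None) (bidx None); pose M : mat := fun i j => g (bidx (Some i)) (bidx (Some j)).
have gE : g = gmx s M.
  apply: mx3P => x y; rewrite gmxE.
  by case: x => [[]|]; case: y => [[]|] //; apply: g0.
pose h := invmx g; pose H : mat := fun i j => h (bidx (Some i)) (bidx (Some j)).
have gh x y : (g *m h) (bidx x) (bidx y) = (x == y)%:R.
  by rewrite mulmxV // mxE; case: x => [[]|]; case: y => [[]|].
have sh : s * h (bidx None) (bidx None) = 1.
  by have := gh None None; rewrite mxE sum_bidx gE !gmxE !mul0r !addr0.
have MH i j : mmul M H i j = (i == j)%:R.
  by have := gh (Some i) (Some j); rewrite mxE sum_bidx gE !gmxE !mul0r add0r.
have MH1 : mdet M * mdet H = 1.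
  transitivity (mdet (mmul M H)); first by rewrite /mdet /mmul; ring.
  by rewrite /mdet !MH /=; ring.
exists s, M; split=> //.
  by apply: contra_eq_neq sh => ->; rewrite mul0r eq_sym oner_eq0.
by apply: contra_eq_neq MH1 => ->; rewrite mul0r eq_sym oner_eq0.
Qed.

Definition conjm M L : mat := mmul (mmul M L) (minv M).
(** The transported form: inverse transpose of [M], times [B], times the inverse of [M]. *)
Definition congr_form M B : mat := fun i j =>
  minv M false i * (B false false * minv M false j + B false true * minv M true j) +
  minv M true i * (B true false * minv M false j + B true true * minv M true j).

Lemma invmx_gmx s M : s != 0 -> mdet M != 0 -> invmx (gmx s M) = gmx s^-1 (minv M).
Proof.
move=> s0 M0; have gV := gmx_mulV s0 M0.
have [g_unit _] := mulmx1_unit gV.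
by rewrite -[LHS]mulmx1 -gV mulmxA mulVmx // mul1mx.
Qed.

Lemma act_gmx s M a L R B : s != 0 -> mdet M != 0 ->
  act (gmx s M) (alg a L R B) =
  alg (a / s) (fun i j => conjm M L i j / s) (fun i j => conjm M R i j / s)
      (fun i j => s * congr_form M B i j).
Proof.
move=> s0 M0; apply: struct_eqP => x y z.
rewrite /act invmx_gmx // !sum_bidx !gmxE !algE.
case: x => [x|]; case: y => [y|]; case: z => [z|];
  rewrite ?(mul0r, mulr0, addr0, add0r) //.
- rewrite /congr_form; ring.
- rewrite /conjm /mmul; ring.
- rewrite /conjm /mmul; ring.
by field.
Qed.

Lemma sorbit_algP a L R B d : sorbit (alg a L R B) d <->
  exists s M, [/\ s != 0, mdet M != 0 & d =
    alg (a / s) (fun i j => conjm M L i j / s) (fun i j => conjm M R i j / s)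
      (fun i j => s * congr_form M B i j)].
Proof.
split=> [[g [/graded_GL_gmx[s [M [s0 M0 ->]]] ->]]|[s [M [s0 M0 ->]]]].
  by exists s, M; rewrite act_gmx.
exists (gmx s M); rewrite act_gmx //; split=> //.
by apply/graded_GL_gmx; exists s, M.
Qed.

(** * The orbits and the twelve components *)

Definition mat0 : mat := fun _ _ => 0.

(* In the Peirce decomposition relative to e1, the vector f1 has type
   (pl1, pr1) and f2 has type (pl2, pr2); pb tells whether f1 f1 = e1. *)
Record ptype := PType { pl1 : bool; pr1 : bool; pl2 : bool; pr2 : bool; pb : bool }.

(** With e1 idempotent and f1 f1 = e1 the only nonzero odd product, associativity forces f1 to have
    type (1,1) and f2 type (0,0). *)
Definition wf_ptype (p : ptype) : bool := pb p ==> [&& pl1 p, pr1 p, ~~ pl2 p & ~~ pr2 p].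

Definition base (p : ptype) : struct := alg 1
  (fun i j => ((i == j) && (if i then pl2 p else pl1 p))%:R)
  (fun i j => ((i == j) && (if i then pr2 p else pr1 p))%:R)
  (fun i j => (pb p && ~~ i && ~~ j)%:R).

(* dot u v times the idempotent with eigenvalue x1 on u and x2 on the kernel of v. *)
Definition pmat (x1 x2 : bool) u v : mat := fun i j =>
  x2%:R * dot u v * (i == j)%:R + (x1%:R - x2%:R) * (u i * v j).

(** Polynomial in [u] and [v], and meaningful also when [dot u v = 0], so it parametrises
    degenerations of [base p] as well as its orbit. *)
Definition palg (p : ptype) (b : CC) u v : struct := alg (dot u v)
  (pmat (pl1 p) (pl2 p) u v) (pmat (pr1 p) (pr2 p) u v) (fun i j => b * (v i * v j)).

Lemma sorbit_base p d : sorbit (base p) d <->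
  exists u v, dot u v != 0 /\ d = palg p (pb p)%:R u v.
Proof.
split=> [/sorbit_algP[s [M [s0 M0 ->]]]|[u [v [a0 ->]]]].
  (* Up to scaling, [u] is the first column of [M] and [v] the first row of its inverse. The root
     [k] absorbs the factor [s] of the form into [v], and [u] is scaled so that
     [dot u v = 1 / s]. *)
  pose k : CC := sqrtC s; have k2 : s = k ^+ 2 by rewrite sqrtCK.
  have k0 : k != 0 by apply: contraNneq s0 => k0; rewrite k2 k0 expr0n.
  exists (fun i => M i false / (s * k)), (fun j => k * minv M false j).
  have dotE : dot (fun i => M i false / (s * k)) (fun j => k * minv M false j) = 1 / s.
    by rewrite /dot /minv /=; move: M0; rewrite /mdet => M0; field; rewrite s0 M0 k0.
  split; first by rewrite dotE mul1r invr_eq0.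
  rewrite /palg /pmat dotE; congr alg; apply: matP => i j; rewrite /conjm /congr_form /mmul.
  - move: M0; rewrite /minv /mdet; case: i; case: j; case: (pl1 p); case: (pl2 p) => /= M0;
      field; rewrite ?s0 ?k0 ?M0 //.
  - move: M0; rewrite /minv /mdet; case: i; case: j; case: (pr1 p); case: (pr2 p) => /= M0;
      field; rewrite ?s0 ?k0 ?M0 //.
  - by rewrite k2; case: (pb p); rewrite /=; ring.
set a := dot u v in a0.
(* The columns of the base change below are [u / w] and a vector spanning the kernel of [v]; the
   form then gets the coefficient [w ^+ 2 / a ^+ 3 = 1]. *)
pose w : CC := sqrtC (a ^+ 3); have w2 : w ^+ 2 = a ^+ 3 by rewrite sqrtCK.
have w0 : w != 0.
  by apply: contra_eq_neq w2 => ->; rewrite expr0n eq_sym expf_neq0.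
pose M : mat := fun i j => if j then (if i then v false else - v true) else u i / w.
have ME : mdet M = a / w by rewrite /mdet /M /a /dot /=; field.
have M0 : mdet M != 0 by rewrite ME mulf_neq0 ?invr_neq0.
apply/sorbit_algP; exists a^-1, M; split=> //; first by rewrite invr_eq0.
rewrite /palg /pmat -/a; congr alg; first by rewrite invrK mul1r.
- apply: matP => i j; rewrite /conjm /mmul /minv ME /M invrK.
  case: i; case: j; case: (pl1 p); case: (pl2 p); rewrite /= /a /dot;
    field; rewrite ?w0 ?a0 //.
- apply: matP => i j; rewrite /conjm /mmul /minv ME /M invrK.
  case: i; case: j; case: (pr1 p); case: (pr2 p); rewrite /= /a /dot;
    field; rewrite ?w0 ?a0 //.
apply: matP => i j.
transitivity ((pb p)%:R * (v i * v j) * (w ^+ 2 / a ^+ 3)).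
  by rewrite w2 divff ?mulr1 // expf_neq0.
rewrite /congr_form /minv ME /M; case: i; case: j; case: (pb p); rewrite /=;
  field; rewrite ?w0 ?a0 //.
Qed.

Lemma assoc_palg p (b : CC) u v : wf_ptype p -> (pb p = false -> b = 0) ->
  AssocVar (palg p b u v).
Proof.
case: p => x1 y1 x2 y2 z /= wf hb; apply/assoc_algP; rewrite /= /pmat /dot.
have zb : b = 0 \/ [/\ x1 = true, y1 = true, x2 = false & y2 = false].
  rewrite /wf_ptype /= in wf.
  by case: z wf hb => [/and4P[-> -> /negPf-> /negPf->] _|_ /(_ erefl) ->]; [right|left].
split=> [i j|i j|i j|i j|i j|i j|i j k l]; rewrite /mmul.
- by case: x1 {wf zb}; case: x2; case: i; case: j; rewrite /=; ring.
- by case: y1 {wf zb}; case: y2; case: i; case: j; rewrite /=; ring.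
- by case: i; case: j; rewrite /=; ring.
- by case: zb => [->|[-> _ -> _]]; case: i; case: j; rewrite /=; ring.
- by case: zb => [->|[_ -> _ ->]]; case: i; case: j; rewrite /=; ring.
- by case: zb => [->|[-> -> -> ->]]; case: i; case: j; rewrite /=; ring.
by case: zb => [->|[-> -> -> ->]]; rewrite /=; ring.
Qed.

(** * The two families with e1 e1 = 0 *)

Definition formalg B : struct := alg 0 mat0 mat0 B.

(** A vector killed by the covector [v] and polynomial in [v]; hence [perp v i * v j] is a
    square-zero matrix. *)
Definition perp v : bool -> CC := fun i => if i then v false else - v true.

Definition nilalg (s t : CC) v : struct := alg 0
  (fun i j => s * (perp v i * v j)) (fun i j => t * (perp v i * v j)) mat0.

Lemma assoc_formalg B : AssocVar (formalg B).
Proof.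
by apply/assoc_algP; split=> *; rewrite /mmul /mat0 ?(mulr0, mul0r, addr0).
Qed.

Lemma assoc_nilalg s t v : AssocVar (nilalg s t v).
Proof.
apply/assoc_algP; split=> *; rewrite /mmul /mat0 ?(mulr0, mul0r, addr0) // /perp; ring.
Qed.

Definition base04 (x : CC) : struct :=
  formalg (fun i j => if i == j then 0 else if i then x - 1 else x + 1).

Definition base06 (x : CC) : struct := alg 0
  (fun i j => if i && ~~ j then 1 + x else 0) (fun i j => if i && ~~ j then 1 - x else 0) mat0.

Lemma sorbit_base04_form x d : sorbit (base04 x) d -> exists B, d = formalg B.
Proof.
move=> /sorbit_algP[s [M [s0 M0 ->]]]; eexists.
rewrite /formalg; congr alg; rewrite ?mul0r //; apply: matP => i j;
  by rewrite /conjm /mmul /mat0 !(mulr0, mul0r, addr0).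
Qed.

(** The third factor is the discriminant of the quadratic form of [B]. When it is nonzero there are
    two isotropic lines, and in a basis of them [B] is antidiagonal. *)
Lemma formalg_sorbit B :
    B false false * (B false true - B true false) *
      ((B false true + B true false) ^+ 2 - 4%:R * B false false * B true true) != 0 ->
  exists x, sorbit (base04 x) (formalg B).
Proof.
rewrite !mulf_eq0 !negb_or => /andP[/andP[b0 d0] disc0].
pose w : CC := sqrtC ((B false true + B true false) ^+ 2 - 4%:R * B false false * B true true).
have w2 : w ^+ 2 = (B false true + B true false) ^+ 2 - 4%:R * B false false * B true true.
  by rewrite sqrtCK.
have w0 : w != 0 by apply: contraNneq disc0 => w0; rewrite -w2 w0 expr0n.
have two0 : 2%:R != 0 :> CC by rewrite pnatr_eq0.
set b := B false false in b0 w2; set d := B false true - B true false in d0.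
set c := B false true + B true false in w2.
(* The columns of M are the two isotropic vectors of B with second coordinate 1. *)
pose M : mat := fun i j => if i then 1 else (if j then - c - w else - c + w) / (2%:R * b).
have ME : mdet M = w / b by rewrite /mdet /M /=; field; rewrite ?two0 ?b0.
have M0 : mdet M != 0 by rewrite ME mulf_neq0 ?invr_neq0.
have B12 : B false true = (c + d) / 2%:R by rewrite /c /d; field.
have B21 : B true false = (c - d) / 2%:R by rewrite /c /d; field.
have B22 : B true true = (c ^+ 2 - w ^+ 2) / (4%:R * b).
  by rewrite w2 -/b; field; rewrite ?b0 ?pnatr_eq0.
have s0 : w * d / (2%:R * b) != 0 by rewrite !mulf_neq0 ?invr_neq0 ?mulf_neq0.
(* In the isotropic basis the skew part of [B] is [w * d / b], whereas [x + 1] and [x - 1] differ by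
   2; this fixes the scalar. The symmetric part then gives [x]. *)
exists (- w / d); apply/sorbit_algP; exists (w * d / (2%:R * b)), M; split=> //.
rewrite /formalg; congr alg; first by rewrite mul0r.
- by apply: matP => i j; rewrite /conjm /mmul /mat0 !(mulr0, mul0r, addr0).
- by apply: matP => i j; rewrite /conjm /mmul /mat0 !(mulr0, mul0r, addr0).
apply: matP => i j; rewrite /congr_form /minv ME /M.
case: i; case: j; rewrite ?B12 ?B21 ?B22 /= -?/b;
  by field; rewrite ?two0 ?b0 ?d0 ?w0 ?pnatr_eq0.
Qed.

(** The determinant and the square of the skew part scale by the same factor, so their ratio is an
    invariant; it determines [x] up to sign. *)
Lemma sorbit_base04_inv x B : sorbit (base04 x) (formalg B) ->
  4%:R * mdet B = (1 - x ^+ 2) * (B false true - B true false) ^+ 2.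
Proof.
move=> /sorbit_algP[s [M [_ _ /alg_inj[_ _ _ ->]]]].
by rewrite /mdet /congr_form /=; ring.
Qed.

Lemma sorbit_base06_nil x d : sorbit (base06 x) d ->
  exists k v, d = nilalg (k * (1 + x)) (k * (1 - x)) v.
Proof.
move=> /sorbit_algP[s [M [s0 M0 ->]]].
(* This [v] is the first row of the adjugate of [M], and [perp v] is the second column of [M]. *)
exists (s * mdet M)^-1, (fun j => if j then - M false true else M true true).
rewrite /nilalg; congr alg; first by rewrite mul0r.
- apply: matP => i j; rewrite /conjm /mmul /minv /perp; move: M0; rewrite /mdet.
  by case: i; case: j => /= M0; field; rewrite M0 s0.
- apply: matP => i j; rewrite /conjm /mmul /minv /perp; move: M0; rewrite /mdet.
  by case: i; case: j => /= M0; field; rewrite M0 s0.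
by apply: matP => i j; rewrite /congr_form /mat0 !(mulr0, mul0r, addr0).
Qed.

Lemma nilalg_sorbit s t v : (s + t) * v false != 0 ->
  exists x, sorbit (base06 x) (nilalg s t v).
Proof.
(* The parameter solves [(1 + x) : (1 - x) = s : t]. *)
rewrite mulf_eq0 negb_or => /andP[st0 v0]; exists ((s - t) / (s + t)).
have two0 : 2%:R != 0 :> CC by rewrite pnatr_eq0.
pose M : mat := fun i j => if j then perp v i else if i then 0 else (v false)^-1.
have ME : mdet M = 1 by rewrite /mdet /M /perp; field.
apply/sorbit_algP; exists (2%:R / (s + t)), M; split.
- by rewrite mulf_neq0 ?invr_neq0.
- by rewrite ME oner_eq0.
rewrite /nilalg; congr alg; first by rewrite mul0r.
- apply: matP => i j; rewrite /conjm /mmul /minv ME /M /perp.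
  by case: i; case: j => /=; field; rewrite ?v0 ?st0.
- apply: matP => i j; rewrite /conjm /mmul /minv ME /M /perp.
  by case: i; case: j => /=; field; rewrite ?v0 ?st0.
by apply: matP => i j; rewrite /congr_form /mat0 !(mulr0, mul0r, addr0).
Qed.

(** Left and right multiplication by e1 are multiples of one nilpotent matrix, and the ratio
    [(1 + x) : (1 - x)] of the multiples is invariant. *)
Lemma sorbit_base06_inj x y : sorbit (base06 x) (base06 y) -> x = y.
Proof.
move=> /sorbit_base06_nil[k [v /alg_inj[_ EL ER _]]].
have := congr1 (fun L => L true false) EL; have := congr1 (fun L => L true false) ER.
rewrite /perp /= => E1 E2.
have E : (1 + y) * (1 - x) = (1 - y) * (1 + x) by rewrite E1 E2; ring.
have two0 : 2%:R != 0 :> CC by rewrite pnatr_eq0.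
by apply: (mulfI two0); apply: (eq_modulo (esym E)); ring.
Qed.

(** * The ten Peirce types and the twelve polynomial charts *)

(** Every unordered pair of Peirce types occurs once, in the order of [rigid_list]. The pair (1,1),
    (0,0) is taken with f1 f1 = e1; the structure with zero odd product is a limit of it. *)
Definition ptypes : seq ptype :=
  [:: PType false true false false false; PType true false false false false;
      PType true true true false false; PType true true false true false;
      PType true true false false true; PType false false false false false;
      PType true false false true false; PType false true false true false;
      PType true false true false false; PType true true true true false].

(** The default value is well formed, so facts such as [component_AssocVar] hold for every index
    without a bound. *)
Definition nth_ptype j := nth (PType false false false false false) ptypes j.

Lemma wf_nth_ptype j : wf_ptype (nth_ptype j).
Proof. by rewrite /nth_ptype; do 10?[case: j => [|j] //]; rewrite nth_default. Qed.

Lemma R04E x : R04 x = base04 x.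
Proof.
apply: struct_eqP => a b c; rewrite /base04 /formalg algE /R04 /mk unlock.
by case: a => [[]|]; case: b => [[]|]; case: c => [[]|]; rewrite /= ?addr0.
Qed.

Lemma R06E x : R06 x = base06 x.
Proof.
apply: struct_eqP => a b c; rewrite /base06 algE /R06 /mk unlock.
by case: a => [[]|]; case: b => [[]|]; case: c => [[]|]; rewrite /= ?addr0.
Qed.

Definition rigid_list : seq struct := [:: R09; R11; R13; R15; R18; R19; R20; R22; R23; R24].

Lemma rigid_listE (j : nat) : (j < 10)%N -> nth R09 rigid_list j = base (nth_ptype j).
Proof.
move=> j10; apply: struct_eqP => a b c; rewrite /base algE.
do 10?[case: j j10 => [|j] j10 //]; 
  rewrite /= /R09 /R11 /R13 /R15 /R18 /R19 /R20 /R22 /R23 /R24 /mk unlock;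
  by case: a => [[]|]; case: b => [[]|]; case: c => [[]|]; rewrite /= ?addr0.
Qed.

Local Notation param := ((bool * bool)%type -> CC).

(** All charts share one parameter space of dimension 4, so a single dimension bound covers the
    twelve sets. *)
Definition chart (k : nat) (t : param) : struct :=
  match k with
  | 0 => formalg (fun i j => t (i, j))
  | 1 => nilalg (t (false, false)) (t (false, true)) (fun j => t (true, j))
  | j.+2 => palg (nth_ptype j) (pb (nth_ptype j))%:R (fun i => t (false, i)) (fun i => t (true, i))
  end.

Lemma polyfun_alg (S : finType) (a : (S -> CC) -> CC) (L R B : (S -> CC) -> mat) :
    polyfun a -> (forall i j, polyfun (fun s => L s i j)) ->
    (forall i j, polyfun (fun s => R s i j)) -> (forall i j, polyfun (fun s => B s i j)) ->
  forall x, polyfun (fun s => alg (a s) (L s) (R s) (B s) x).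
Proof.
move=> Pa PL PR PB [[i j] k].
have [x ->] := bidxP i; have [y ->] := bidxP j; have [z ->] := bidxP k.
rewrite (_ : (fun s => _) = fun s => match x, y, z with
    | None, None, None => a s
    | None, Some j, Some k => L s k j
    | Some i, None, Some k => R s k i
    | Some i, Some j, None => B s i j
    | _, _, _ => 0
    end); last by apply: funext => s; rewrite algE.
by case: x => [x|]; case: y => [y|]; case: z => [z|] //; apply: polyfun_const.
Qed.

Ltac polyfun_tac := repeat first
  [ apply: polyfun_const | apply: polyfun_coord
  | apply: polyfunD | apply: polyfunN | apply: polyfunM | apply: polyfunX ].

Lemma polyfun_chart k x : polyfun (fun t => chart k t x).
Proof.
case: k => [|[|k]]; apply: polyfun_alg => [|i j|i j|i j];
  rewrite /mat0 /pmat /perp /dot; do ?[case: i]; polyfun_tac.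
Qed.

Definition component k : struct -> Prop := zclosure (image_of (chart k)).

Lemma zclosed_component k : zclosed (component k).
Proof. exact: zclosed_zclosure. Qed.

Lemma irreducible_component k : irreducible (component k).
Proof. exact/irreducible_image/polyfun_chart. Qed.

Lemma component_no_chain k : ~ has_chain (component k) 5.
Proof.
by apply: image_no_chain; [apply: polyfun_chart | rewrite card_prod card_bool].
Qed.

Lemma component_AssocVar k : subset_of (component k) AssocVar.
Proof.
apply: zclosure_min; first exact: zclosed_AssocVar.
move=> _ [t ->]; case: k => [|[|k]]; first exact: assoc_formalg.
  exact: assoc_nilalg.
by apply: assoc_palg; [apply: wf_nth_ptype | move=> ->].
Qed.

Lemma zclosure_eq (T : finType) (A C : (T -> CC) -> Prop) :
  subset_of A (zclosure C) -> subset_of C (zclosure A) -> seteq (zclosure A) (zclosure C).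
Proof. by move=> AC CA x; split; apply: zclosure_sub. Qed.

(** By [sorbit_base] the orbit is the image of the dense open set [dot u v != 0] of the chart. *)
Lemma component_base j : seteq (orbit_cl (base (nth_ptype j))) (component j.+2).
Proof.
apply: zclosure_eq.
  move=> d /sorbit_base[u [v [_ ->]]]; apply: sub_zclosure.
  by exists (fun x => if x.1 then v x.2 else u x.2).
apply: (@dense_image _ _ _ (polyfun_chart j.+2) _
  (fun t => dot (fun i => t (false, i)) (fun i => t (true, i))) (fun=> 1)).
- by rewrite /dot; polyfun_tac.
- by rewrite /dot mulr1 -[1 + 1]/(2%:R) pnatr_eq0.
by move=> t t0; apply/sorbit_base; do 2!eexists; split; first exact: t0.
Qed.

Lemma component_R04 : seteq (family_orbit_cl R04) (component 0).
Proof.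
apply: zclosure_eq.
  move=> d [x]; rewrite R04E => /sorbit_base04_form[B ->].
  by apply: sub_zclosure; exists (fun x => B x.1 x.2).
apply: (@dense_image _ _ _ (polyfun_chart 0) _ (fun t =>
    t (false, false) * (t (false, true) - t (true, false)) *
    ((t (false, true) + t (true, false)) ^+ 2 - 4%:R * t (false, false) * t (true, true)))
  (fun x => if x == (true, true) then 0 else if x == (true, false) then 0 else 1)).
- by polyfun_tac.
- by rewrite /= subr0 addr0 mulr0 subr0 expr1n !mulr1 oner_eq0.
by move=> t /(formalg_sorbit (B := fun i j => t (i, j)))[x Hx]; exists x; rewrite R04E.
Qed.

Lemma component_R06 : seteq (family_orbit_cl R06) (component 1).
Proof.
apply: zclosure_eq.
  move=> d [x]; rewrite R06E => /sorbit_base06_nil[k [v ->]]; apply: sub_zclosure.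
  by exists (fun y => if y.1 then v y.2 else k * (if y.2 then 1 - x else 1 + x)).
apply: (@dense_image _ _ _ (polyfun_chart 1) _ (fun t =>
    (t (false, false) + t (false, true)) * t (true, false)) (fun=> 1)).
- by polyfun_tac.
- by rewrite mulr1 -[1 + 1]/(2%:R) pnatr_eq0.
by move=> t /(nilalg_sorbit (v := fun j => t (true, j)))[x Hx]; exists x; rewrite R06E.
Qed.

(** * Classification of associative structures *)

Definition nonscalar M : bool :=
  [|| M false true != 0, M true false != 0 | M false false != M true true].

Lemma nonscalarN M : ~~ nonscalar M -> M = scal (M false false).
Proof.
rewrite !negb_or !negbK => /and3P[/eqP M1 /eqP M2 /eqP M3].
by apply: matP => -[] []; rewrite /scal /= ?mulr1 ?mulr0.
Qed.

Lemma nonscalar_free M z w : nonscalar M ->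
  (forall i j, z * (i == j)%:R + w * M i j = 0) -> z = 0 /\ w = 0.
Proof.
move=> ns H; have w0 : w = 0.
  have := H false true; have := H true false; have := H false false; have := H true true.
  rewrite /= !mulr0 !mulr1 !add0r => H1 H2 H3 H4; apply/eqP; move: ns; case/or3P => M0.
  - by move/eqP: H4; rewrite mulf_eq0 (negPf M0) orbF.
  - by move/eqP: H3; rewrite mulf_eq0 (negPf M0) orbF.
  have /eqP : w * (M false false - M true true) = 0 by apply: (eq_modulo (etrans H2 (esym H1))); ring.
  by rewrite mulf_eq0 subr_eq0 (negPf M0) orbF.
by split=> //; have := H true true; rewrite w0 mul0r addr0 mulr1.
Qed.

Lemma outerP M : mdet M = 0 -> exists u v, M = outer u v.
Proof.
rewrite /mdet => M0.
have [M1|M1] := eqVneq (M false false) 0; last first.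
  exists (fun i => M i false / M false false), (M false).
  apply: matP => i j; rewrite /outer.
  suff E : M i j * M false false = M i false * M false j by rewrite mulrAC -E mulfK.
  by case: i; case: j; (ring || (apply: (eq_modulo M0); ring)).
have [M2|M2] := eqVneq (M false true) 0.
  exists (fun i => i%:R), (M true).
  by apply: matP => -[] []; rewrite /outer ?mul1r ?mul0r.
exists (fun i => M i true), (fun j => j%:R).
have M3 : M true false = 0.
  by apply: (mulfI M2); apply: (eq_modulo (esym M0)); rewrite M1; ring.
by apply: matP => -[] []; rewrite /outer ?mulr1 ?mulr0.
Qed.

(** [M] satisfies both its characteristic equation and [M ^ 2 = a M]; since [M] is not scalar the
    two coincide, so [M] has determinant 0 and trace [a]. *)
Lemma quadratic_outer M a : nonscalar M -> (forall i j, mmul M M i j = a * M i j) ->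
  exists u v, M = outer u v /\ dot u v = a.
Proof.
move=> ns MM.
(* Cayley-Hamilton *)
have [|det0 tr] := nonscalar_free (z := - mdet M) (w := M false false + M true true - a) ns.
  move=> i j; have := MM i j; rewrite /mmul /mdet => E.
  by apply: (eq_modulo E); case: i {E}; case: j => /=; ring.
have [u [v ME]] : exists u v, M = outer u v.
  by apply: outerP; apply/eqP; rewrite -oppr_eq0 det0.
exists u, v; split=> //; apply/eqP; rewrite -subr_eq0 -tr ME /outer /dot; apply/eqP; ring.
Qed.

(** Commuting means that the triples formed by the two off-diagonal entries and the difference of
    the diagonal entries are proportional for [M] and [R]. Each case divides by a nonzero entry of
    the triple of [M]. *)
Lemma commutant M R : nonscalar M -> (forall i j, mmul M R i j = mmul R M i j) ->
  exists x y, R = fun i j => x * (i == j)%:R + y * M i j.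
Proof.
move=> ns MR.
have E1 : M false true * R true false = R false true * M true false.
  by apply: (eq_modulo (MR false false)); rewrite /mmul; ring.
have E2 : M false true * (R false false - R true true) =
    R false true * (M false false - M true true).
  by apply: (eq_modulo (esym (MR false true))); rewrite /mmul; ring.
have E3 : M true false * (R false false - R true true) =
    R true false * (M false false - M true true).
  by apply: (eq_modulo (MR true false)); rewrite /mmul; ring.
case/or3P: ns => M0.
- exists (R false false - R false true / M false true * M false false), (R false true / M false true).
  apply: matP => i j; apply: (mulfI M0).
  case: i; case: j => /=; try by field.
  + by apply: (eq_modulo (esym E2)); field.
  by apply: (eq_modulo E1); field.
- exists (R false false - R true false / M true false * M false false), (R true false / M true false).
  apply: matP => i j; apply: (mulfI M0).
  case: i; case: j => /=; try by field.
  + by apply: (eq_modulo (esym E3)); field.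
  by apply: (eq_modulo (esym E1)); field.
rewrite -subr_eq0 in M0.
pose y := (R false false - R true true) / (M false false - M true true).
exists (R false false - y * M false false), y.
apply: matP => i j; apply: (mulfI M0); rewrite /y.
case: i; case: j => /=; try by field.
  by apply: (eq_modulo (esym E3)); field.
by apply: (eq_modulo (esym E2)); field.
Qed.

(** The vector [u] lies in the kernel of [v], which is the line of [perp v] unless [v] is zero. *)
Lemma outer_perp u v : dot u v = 0 -> exists k, outer u v = fun i j => k * (perp v i * v j).
Proof.
move=> uv0; have [v1|v1] := eqVneq (v false) 0; last first.
  exists (u true / v false); apply: matP => i j.
  rewrite /outer; suff -> : u i = u true / v false * perp v i by rewrite mulrA.
  case: i; rewrite /perp /=; first by field.
  by apply: (mulfI v1); apply: (eq_modulo uv0); rewrite /dot; field.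
have [v2|v2] := eqVneq (v true) 0.
  by exists 0; apply: matP => i [] ; rewrite /outer ?v1 ?v2 !mulr0.
exists (- u false / v true); apply: matP => i j.
rewrite /outer; suff -> : u i = - u false / v true * perp v i by rewrite mulrA.
case: i; rewrite /perp /=; last by field.
by apply: (mulfI v2); apply: (eq_modulo uv0); rewrite /dot v1; field.
Qed.

(** In the third shape [b] stays free when [pb] holds; structures with [b = 0] are then in general
    only limits of the chart. *)
Definition canonical_form (c : struct) : Prop :=
  [\/ exists B, c = formalg B, exists s t v, c = nilalg s t v |
      exists j b u v, [/\ (j < 10)%N, pb (nth_ptype j) = false -> b = 0 &
                          c = palg (nth_ptype j) b u v]].

Lemma palg_form j a L R B u v : (j < 10)%N -> dot u v = a -> B = mat0 ->
    L = pmat (pl1 (nth_ptype j)) (pl2 (nth_ptype j)) u v ->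
    R = pmat (pr1 (nth_ptype j)) (pr2 (nth_ptype j)) u v ->
  canonical_form (alg a L R B).
Proof.
move=> j10 uv -> -> ->; apply: Or33; exists j, 0, u, v; split=> //.
by rewrite /palg uv; congr alg; apply: matP => i k; rewrite mul0r.
Qed.

Lemma scal_quadratic (l a : CC) : (forall i j, mmul (scal l) (scal l) i j = a * scal l i j) ->
  l = 0 \/ l = a.
Proof.
move=> /(_ false false); rewrite /mmul /scal /= => E.
have /eqP : l * (l - a) = 0 by apply: (eq_modulo E); ring.
by rewrite mulf_eq0 subr_eq0 => /orP[] /eqP; [left | right].
Qed.

(** The matrices [L] and [R] commute and satisfy [X ^ 2 = a X]. Either both are scalar, or one that
    is not is an outer product of trace [a] and the other lies in its commutant. *)
Lemma canonical_noform a L R : assoc_data a L R mat0 -> canonical_form (alg a L R mat0).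
Proof.
case=> LL RR LR _ _ _ _.
(* When [L] and [R] are both scalar, any pair of vectors with [dot] equal to [a] will do. *)
pose u0 (i : bool) : CC := if i then 0 else a; pose v0 (i : bool) : CC := if i then 0 else 1.
have uv0 : dot u0 v0 = a by rewrite /dot /=; ring.
have [Lns|/nonscalarN] := boolP (nonscalar L); last first.
  move: (L false false) => l LE; rewrite {}LE in LL LR *.
  have [Rns|/nonscalarN] := boolP (nonscalar R).
    have [u [v [RE uv]]] := quadratic_outer Rns RR.
    case: (scal_quadratic LL) => ->.
    - apply: (@palg_form 0 _ _ _ _ u v) => //; apply: matP => i j;
        by rewrite ?RE /outer /pmat /scal /=; ring.
    by apply: (@palg_form 2 _ _ _ _ u v) => //; apply: matP => i j;
        rewrite ?RE /outer /pmat /scal /= ?uv; ring.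
  move: (R false false) => r RE; rewrite {}RE in RR LR *.
  by case: (scal_quadratic LL) => ->; case: (scal_quadratic RR) => ->;
   [ apply: (@palg_form 5 _ _ _ _ u0 v0) | apply: (@palg_form 7 _ _ _ _ u0 v0)
   | apply: (@palg_form 8 _ _ _ _ u0 v0) | apply: (@palg_form 9 _ _ _ _ u0 v0)] => //;
   apply: matP => i j; rewrite /outer /pmat /scal /= ?uv0; ring.
have [u [v [LE uv]]] := quadratic_outer Lns LL.
have [x [y RE]] := commutant Lns LR.
(* Coefficients of [R ^ 2 - a R] in the basis formed by the identity and [L], reduced by
   [L ^ 2 = a L]. They give [x = 0] or [x = a]; then [y = 0], [a = 0], or [y] is 1 or -1
   respectively. The case [a = 0] is the nilpotent shape. *)
have [|x0 y0] := nonscalar_free (z := x ^+ 2 - a * x) (w := y * (2%:R * x + y * a - a)) Lns.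
  move=> i j; have := RR i j; have := LL i j; rewrite RE /mmul => EL ER.
  have E2 : y ^+ 2 * (L i false * L false j + L i true * L true j) = y ^+ 2 * (a * L i j) by rewrite EL.
  apply: (eq_modulo (f_equal2 (fun s t : CC => s - t) ER E2)).
  by case: i {EL ER E2}; case: j => /=; ring.
have /eqP : x * (x - a) = 0 by apply: (eq_modulo x0); ring.
rewrite mulf_eq0 subr_eq0 => /orP[] /eqP xE; subst x.
  have /eqP : y * (a * (y - 1)) = 0 by apply: (eq_modulo y0); ring.
  rewrite !mulf_eq0 subr_eq0 => /or3P[] /eqP E.
  - by apply: (@palg_form 1 _ _ _ _ u v) => //; apply: matP => i j;
      rewrite ?RE ?E ?LE /outer /pmat /=; ring.
  - have [k LE'] : exists k, outer u v = fun i j => k * (perp v i * v j).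
      by apply: outer_perp; rewrite uv E.
    apply: Or32; exists k, (y * k), v; rewrite /nilalg RE LE LE' E.
    by congr alg; apply: matP => i j; ring.
  by apply: (@palg_form 4 _ _ _ _ u v) => //; apply: matP => i j;
    rewrite ?RE ?E ?LE /outer /pmat /=; ring.
have /eqP : y * (a * (y + 1)) = 0 by apply: (eq_modulo y0); ring.
rewrite !mulf_eq0 => /or3P[] /eqP E.
- by apply: (@palg_form 3 _ _ _ _ u v) => //; apply: matP => i j;
    rewrite ?RE ?E ?LE /outer /pmat /= ?uv; ring.
- have [k LE'] : exists k, outer u v = fun i j => k * (perp v i * v j).
    by apply: outer_perp; rewrite uv E.
  apply: Or32; exists k, (y * k), v; rewrite /nilalg RE LE LE' E.
  by congr alg; apply: matP => i j; ring.
have {}E : y = -1 by apply/eqP; rewrite -addr_eq0 E.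
by apply: (@palg_form 6 _ _ _ _ u v) => //; apply: matP => i j;
  rewrite ?RE ?E ?LE /outer /pmat /= ?uv; ring.
Qed.

Lemma mat_neq0 M : M <> mat0 -> exists i j, M i j != 0.
Proof.
move=> M0; apply: contrapT => H; apply: M0; apply: matP => i j; apply/eqP.
by apply: contraT => Mij; case: H; exists i, j.
Qed.

(** Everything comes from the triples of odd vectors: a nonzero entry of [B] either makes [L], [R]
    and [a] vanish, or forces [L = R] of rank one and [B] proportional to [v v]. *)
Lemma canonical_form_neq0 a L R B : B <> mat0 -> assoc_data a L R B ->
  canonical_form (alg a L R B).
Proof.
move=> /mat_neq0[p [q Bpq]] [LL _ _ LB _ _ BLR].
have [L0|/mat_neq0[m [n Lmn]]] := EM (L = mat0).
  apply: Or31; exists B; rewrite L0 in LB BLR *.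
  have -> : R = mat0.
    apply: matP => l i; apply: (mulfI Bpq); rewrite -BLR /mat0 mulr0 mulr0 //.
  suff -> : a = 0 by [].
  by apply: (mulIf Bpq); rewrite -LB /mat0 !mul0r addr0.
pose v k := B q k; pose u l := R l p / B p q.
have LE l k : L l k = u l * v k.
  by apply: (mulfI Bpq); rewrite BLR /u /v; field.
have /andP[um vn] : (u m != 0) && (v n != 0) by rewrite -negb_or -mulf_eq0 -LE.
(* Fixing the nonzero entry [L m n] instead expresses [B i j] through column [n] of [B]; applied
   twice, this shows that [B] is symmetric of rank one. *)
have BE i j : B i j * (u m * v n) = B j n * R m i by rewrite -LE BLR.
pose f i := R m i / (u m * v n).
have {}BE i j : B i j = f i * f j * B n n.
  have E i' j' : B i' j' = f i' * B j' n.
    by apply: (mulIf (mulf_neq0 um vn)); rewrite BE /f; field; rewrite um vn.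
  by rewrite E (E j n) mulrA.
pose k := f q * B n n.
have vE j : v j = k * f j by rewrite /v BE /k; ring.
have k0 : k != 0 by apply: contraNneq vn => k0; rewrite vE k0 mul0r.
have Bnn : B n n != 0 by apply: contraNneq k0 => b0; rewrite /k b0 mulr0.
have {}BE i j : B i j = B n n / k ^+ 2 * (v i * v j) by rewrite BE !vE; field.
have RE l i : R l i = u l * v i.
  apply: (mulfI Bnn); rewrite -BLR LE (BE i n) [in RHS](BE n n); ring.
apply: Or33; exists 4, (B n n / k ^+ 2), u, v; split=> //.
have uv : dot u v = a.
  by apply: (mulIf Lmn); rewrite -LL /mmul !LE /dot; ring.
by rewrite /palg uv; congr alg; apply: matP => i j; rewrite ?LE ?RE // /pmat /=; ring.
Qed.

Lemma AssocVar_canonical c : AssocVar c -> canonical_form c.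
Proof.
move=> Xc; have [a [L [R [B cE]]]] : exists a L R B, c = alg a L R B.
  by do 4!eexists; apply: evenE (proj1 Xc).
rewrite cE in Xc *; move: Xc => /assoc_algP.
by case: (EM (B = mat0)) => [->|B0]; [apply: canonical_noform | apply: canonical_form_neq0].
Qed.

(** * Separation of the components *)

Lemma palg_affine p b u v x :
  palg p b u v x = palg p 0 u v x + b * (palg p 1 u v x - palg p 0 u v x).
Proof.
case: x => [[i j] k].
have [x ->] := bidxP i; have [y ->] := bidxP j; have [z ->] := bidxP k.
by rewrite /palg !algE; case: x => [x|]; case: y => [y|]; case: z => [z|]; ring.
Qed.

(** Inverse scaling of [u] and [v] keeps [outer u v] and [dot u v]. Over the complex numbers it
    normalises every nonzero [b] to 1. *)
Lemma palg_rescale p b k u v : k != 0 ->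
  palg p (b * k ^+ 2) u v = palg p b (fun i => u i / k) (fun i => k * v i).
Proof.
move=> k0; have uv : dot (fun i => u i / k) (fun i => k * v i) = dot u v.
  by rewrite /dot; field.
rewrite /palg uv /pmat uv; congr alg; apply: matP => i j; by field.
Qed.

(** A nonzero [b] is a square and is scaled to 1. The value 0 is the limit at [e = 0] of the curve
    with coefficient [e ^+ 2]. *)
Lemma palg_component j b u v : (pb (nth_ptype j) = false -> b = 0) ->
  component j.+2 (palg (nth_ptype j) b u v).
Proof.
set p := nth_ptype j => hb.
have mem u' v' : component j.+2 (palg p (pb p)%:R u' v').
  by apply: sub_zclosure; exists (fun x => if x.1 then v' x.2 else u' x.2).
have [pbT|/negbTE pbF] := boolP (pb p); last by have := mem u v; rewrite pbF (hb pbF).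
rewrite {}pbT in hb mem.
have sq k : k != 0 -> component j.+2 (palg p (k ^+ 2) u v).
  by move=> k0; rewrite -[k ^+ 2]mul1r palg_rescale //; apply: mem.
have [->|b0] := eqVneq b 0; last first.
  by rewrite -[b]sqrtCK; apply: sq; rewrite sqrtC_eq0.
pose c x : {poly CC} := (palg p 0 u v x)%:P + (palg p 1 u v x - palg p 0 u v x)%:P * 'X^2.
have cE e : (fun x => (c x).[e]) = palg p (e ^+ 2) u v.
  by apply: funext => x; rewrite palg_affine /c hornerD hornerM !hornerC hornerXn mulrC.
have X0 : 'X != 0 :> {poly CC} by rewrite polyX_eq0.
have := zclosure_curve (S := image_of (chart j.+2)) (c := c) X0 _ 0.
rewrite cE expr0n; apply => e; rewrite hornerX cE; exact: sq.
Qed.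

Lemma base_palg j : base (nth_ptype j) = palg (nth_ptype j) (pb (nth_ptype j))%:R
  (fun i => (~~ i)%:R) (fun i => (~~ i)%:R).
Proof.
case: (nth_ptype j) => x1 y1 x2 y2 z; rewrite /base /palg /pmat /dot.
congr alg => /=; first by ring.
- by apply: matP => -[] []; case: x1; case: x2; rewrite /=; ring.
- by apply: matP => -[] []; case: y1; case: y2; rewrite /=; ring.
by apply: matP => -[] []; case: z; rewrite /=; ring.
Qed.

Lemma AssocVar_cover c : AssocVar c -> exists2 k, (k < 12)%N & component k c.
Proof.
move=> /AssocVar_canonical[[B ->]|[s [t [v ->]]]|[j [b [u [v [j10 hb ->]]]]]].
- by exists 0%N => //; apply: sub_zclosure; exists (fun x => B x.1 x.2).
- exists 1%N => //; apply: sub_zclosure.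
  by exists (fun x => if x.1 then v x.2 else if x.2 then t else s).
by exists j.+2 => //; apply: palg_component.
Qed.

Definition cA (c : struct) : CC := c (bidx None, bidx None, bidx None).
Definition cL (c : struct) : mat := fun k j => c (bidx None, bidx (Some j), bidx (Some k)).
Definition cR (c : struct) : mat := fun k j => c (bidx (Some j), bidx None, bidx (Some k)).
Definition cB (c : struct) : mat := fun i j => c (bidx (Some i), bidx (Some j), bidx None).

Lemma cA_alg a L R B : cA (alg a L R B) = a. Proof. exact: algE. Qed.
Lemma cL_alg a L R B : cL (alg a L R B) = L.
Proof. by apply: matP => i j; apply: algE. Qed.
Lemma cR_alg a L R B : cR (alg a L R B) = R.
Proof. by apply: matP => i j; apply: algE. Qed.
Lemma cB_alg a L R B : cB (alg a L R B) = B.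
Proof. by apply: matP => i j; apply: algE. Qed.
Definition c_alg := (cA_alg, cL_alg, cR_alg, cB_alg).

Lemma component_identity k (f g : struct -> CC) : polyfun f -> polyfun g ->
  (forall t, f (chart k t) = g (chart k t)) -> forall c, component k c -> f c = g c.
Proof.
move=> Pf Pg fg c kc; apply/eqP; rewrite -subr_eq0; apply/eqP.
apply: (kc (fun c => f c - g c = 0)); first exact/zclosed_zero/polyfunB.
by move=> _ [t ->]; rewrite fg subrr.
Qed.

Lemma polyfun_cA : polyfun cA. Proof. exact: polyfun_coord. Qed.
Lemma polyfun_cL i j : polyfun (fun c => cL c i j). Proof. exact: polyfun_coord. Qed.
Lemma polyfun_cR i j : polyfun (fun c => cR c i j). Proof. exact: polyfun_coord. Qed.
Lemma polyfun_cB i j : polyfun (fun c => cB c i j). Proof. exact: polyfun_coord. Qed.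

Lemma component0_LR c : component 0 c -> [/\ cA c = 0, cL c = mat0 & cR c = mat0].
Proof.
move=> H; have P0 := @polyfun_const idx 0; split; [|apply: matP => i j..].
- by apply: (component_identity polyfun_cA P0 _ H) => t; rewrite c_alg.
- by apply: (component_identity (polyfun_cL i j) P0 _ H) => t; rewrite c_alg.
by apply: (component_identity (polyfun_cR i j) P0 _ H) => t; rewrite c_alg.
Qed.

Lemma component1_AB c : component 1 c -> cA c = 0 /\ cB c = mat0.
Proof.
move=> H; have P0 := @polyfun_const idx 0; split; [|apply: matP => i j].
  by apply: (component_identity polyfun_cA P0 _ H) => t; rewrite c_alg.
by apply: (component_identity (polyfun_cB i j) P0 _ H) => t; rewrite c_alg.
Qed.

Lemma componentS_B_sym k c : component k.+1 c -> cB c false true = cB c true false.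
Proof.
apply: (component_identity (polyfun_cB false true) (polyfun_cB true false)) => t.
by case: k => [|k]; rewrite !c_alg //; ring.
Qed.

(** On the chart, these entries of [L] and [R] are the same entry of [outer u v] multiplied by
    differences of Peirce eigenvalues. *)
Lemma component_offdiag j c (p := nth_ptype j) : component j.+2 c ->
  ((pr1 p)%:R - (pr2 p)%:R) * cL c true false = ((pl1 p)%:R - (pl2 p)%:R) * cR c true false /\
  (pl1 p = pl2 p -> cL c true false = 0).
Proof.
move=> H; split=> [|plE].
  apply: (component_identity (polyfunM (@polyfun_const idx _) (polyfun_cL true false))
    (polyfunM (@polyfun_const idx _) (polyfun_cR true false)) _ H) => t.
  by rewrite !c_alg -/p /pmat /=; ring.
apply: (component_identity (polyfun_cL true false) (@polyfun_const idx _) _ H) => t.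
by rewrite !c_alg -/p /pmat /= plE; ring.
Qed.

(* The traces of left and right multiplication by e1, and of their product, for a = 1. *)
Definition traces (p : ptype) : nat * nat * nat :=
  (pl1 p + pl2 p, pr1 p + pr2 p, (pl1 p && pr1 p) + (pl2 p && pr2 p))%N.

Lemma component_traces j c (t := traces (nth_ptype j)) : component j.+2 c ->
  [/\ cL c false false + cL c true true = t.1.1%:R * cA c,
      cR c false false + cR c true true = t.1.2%:R * cA c &
      mmul (cL c) (cR c) false false + mmul (cL c) (cR c) true true = t.2%:R * cA c ^+ 2].
Proof.
have P_trace (M : struct -> mat) : (forall i, polyfun (fun c => M c i i)) ->
    polyfun (fun c => M c false false + M c true true) by move=> PM; apply: polyfunD.
have P_mul i : polyfun (fun c => mmul (cL c) (cR c) i i).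
  by apply: polyfunD; apply: polyfunM; (exact: polyfun_cL) || (exact: polyfun_cR).
rewrite {}/t; move=> H; split.
- apply: (component_identity (P_trace cL (fun i => polyfun_cL i i))
    (polyfunM (@polyfun_const idx _) polyfun_cA) _ H) => t.
  by rewrite !c_alg /pmat /dot /traces natrD /=; ring.
- apply: (component_identity (P_trace cR (fun i => polyfun_cR i i))
    (polyfunM (@polyfun_const idx _) polyfun_cA) _ H) => t.
  by rewrite !c_alg /pmat /dot /traces natrD /=; ring.
apply: (component_identity (P_trace (fun c => mmul (cL c) (cR c)) P_mul)
  (polyfunM (@polyfun_const idx _) (polyfunX 2 polyfun_cA)) _ H) => t.
rewrite !c_alg /pmat /mmul /dot /traces.
by case: (nth_ptype j) => [[] [] [] [] z] /=; ring.
Qed.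

(** The traces of [L] and [R] alone separate all types except the pairs (1,1), (0,0) and (1,0),
    (0,1), which the trace of the product tells apart. *)
Lemma traces_inj : {in gtn 10 &, injective (fun j => traces (nth_ptype j))}.
Proof.
move=> i j i10 j10; have uniq_t : uniq [seq traces p | p <- ptypes] by [].
have nthE k : (k < 10)%N -> traces (nth_ptype k) = nth (0,0,0)%N [seq traces p | p <- ptypes] k.
  by move=> k10; rewrite (nth_map (PType false false false false false)).
by rewrite !nthE // => /eqP; rewrite nth_uniq // => /eqP.
Qed.

(** Where e1 e1 is nonzero, the trace identities can be divided by powers of [cA c] and determine
    the Peirce types. *)
Lemma component_meet i j c : (i < 10)%N -> (j < 10)%N -> cA c != 0 ->
  component i.+2 c -> component j.+2 c -> i = j.
Proof.
move=> i10 j10 a0 /component_traces[E1 E2 E3] /component_traces[]; rewrite E1 E2 E3.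
move=> /(mulIf a0)/eqP + /(mulIf a0)/eqP + /(mulIf (expf_neq0 2 a0))/eqP.
rewrite !eqr_nat => /eqP T1 /eqP T2 /eqP T3; apply: traces_inj => //=.
by rewrite [LHS]surjective_pairing [in LHS](surjective_pairing _.1) T1 T2 T3 -!surjective_pairing.
Qed.

Lemma base_component j : component j.+2 (base (nth_ptype j)).
Proof. by rewrite base_palg; apply: palg_component => ->. Qed.

Lemma component_cA k c : (k < 2)%N -> component k c -> cA c = 0.
Proof. by case: k => [|[|]] // _; [case/component0_LR | case/component1_AB]. Qed.

Lemma component_subset k l :
  (k < 12)%N -> (l < 12)%N -> subset_of (component k) (component l) -> k = l.
Proof.
move=> k12 l12 kl; case: k k12 kl => [_|[_|k k12]] kl.
(* The test point is a form that is not symmetric. *)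
- case: l l12 kl => [//|l] _ /(_ (formalg (fun i _ => i%:R))) H.
  have /componentS_B_sym : component l.+1 (formalg (fun i _ => i%:R)).
    by apply: H; apply: sub_zclosure; exists (fun x : bool * bool => x.1%:R).
  by rewrite c_alg => /eqP; rewrite eq_sym oner_eq0.
(* The test point has [L = 2 R] with [R] nonzero and nilpotent. In a Peirce component this would
   require [2 * (y1 - y2) = x1 - x2] with [x1 != x2], impossible for values 0 and 1. *)
- pose v (i : bool) : CC := (~~ i)%:R.
  have mem : component 1 (nilalg 2%:R 1 v).
    apply: sub_zclosure.
    by exists (fun x => if x.1 then v x.2 else if x.2 then 1 else 2%:R).
  have two0 : 2%:R != 0 :> CC by rewrite pnatr_eq0.
  case: l l12 kl => [_ /(_ _ mem)|[//|l] _ /(_ _ mem)].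
    case/component0_LR => _ /(congr1 (fun M : mat => M true false)).
    by rewrite c_alg /perp /v /mat0 /= !mulr1 => /eqP; rewrite (negPf two0).
  case/component_offdiag; rewrite !c_alg /perp /v /= !mulr1.
  case: (nth_ptype l) => x1 y1 x2 y2 z /= E1 E2.
  case: (eqVneq x1 x2) => [/E2/eqP|x12]; first by rewrite (negPf two0).
  have : (((y1%:Z - y2%:Z) * 2)%:~R : CC) = (x1%:Z - x2%:Z)%:~R.
    by rewrite rmorphM !rmorphB.
  move=> /eqP; rewrite eqr_int; by case: x1 x12 {E1 E2}; case: x2; case: y1; case: y2.
(* The test point has e1 e1 = e1, so the traces decide. *)
have k0 := @base_component k; have := kl _ k0.
have a1 : cA (base (nth_ptype k)) = 1 by rewrite c_alg.
case: l l12 {kl} => [|[|l]] l12 lk.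
- by have /eqP := component_cA (k := 0%N) isT lk; rewrite a1 oner_eq0.
- by have /eqP := component_cA (k := 1%N) isT lk; rewrite a1 oner_eq0.
by congr _.+2; apply: component_meet k0 lk; rewrite // a1 oner_eq0.
Qed.

(** * Components, dimension and rigidity *)

Lemma mdet_minv M : mdet M != 0 -> mdet (minv M) = (mdet M)^-1.
Proof. by rewrite /minv /mdet /= => M0; field. Qed.

Lemma minvK M : mdet M != 0 -> minv (minv M) = M.
Proof.
move=> M0; apply: matP => i j; rewrite {1}/minv mdet_minv // invrK /minv.
by case: i; case: j => /=; field.
Qed.

Lemma mdetM M L : mdet (mmul M L) = mdet M * mdet L.
Proof. by rewrite /mdet /mmul; ring. Qed.

Lemma minv_mul M L : mdet M != 0 -> mdet L != 0 -> minv (mmul M L) = mmul (minv L) (minv M).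
Proof.
move=> M0 L0; apply: matP => i j; rewrite {1}/minv mdetM /mmul /minv.
by case: i; case: j => /=; field; rewrite M0 L0.
Qed.

Lemma mmul_minv M i j : mdet M != 0 -> mmul (minv M) M i j = (i == j)%:R.
Proof. by rewrite /mmul /minv /mdet => M0; case: i; case: j => /=; field. Qed.

Lemma conjmV M L i j : mdet M != 0 -> conjm (minv M) (conjm M L) i j = L i j.
Proof.
move=> M0; have VM := fun i j => mmul_minv i j M0.
have -> : conjm (minv M) (conjm M L) i j = mmul (mmul (mmul (minv M) M) L) (mmul (minv M) M) i j.
  by rewrite /conjm minvK // /mmul; ring.
by rewrite /mmul in VM *; rewrite !VM; case: i; case: j => /=; ring.
Qed.

Lemma congr_formV M B i j : mdet M != 0 -> congr_form (minv M) (congr_form M B) i j = B i j.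
Proof.
move=> M0; have VM := fun i j => mmul_minv i j M0.
pose N := mmul (minv M) M.
have -> : congr_form (minv M) (congr_form M B) i j =
    N false i * (B false false * N false j + B false true * N true j) +
    N true i * (B true false * N false j + B true true * N true j).
  by rewrite /N /congr_form minvK // /mmul; ring.
by rewrite /N !VM; case: i; case: j => /=; ring.
Qed.

Lemma sorbit_refl a L R B : sorbit (alg a L R B) (alg a L R B).
Proof.
apply/sorbit_algP; exists 1, (fun i j => (i == j)%:R).
have M1 : mdet (fun i j => (i == j)%:R) = 1 by rewrite /mdet /=; ring.
split; rewrite ?M1 ?oner_eq0 //; congr alg; first by rewrite divr1.
- by apply: matP => i j; rewrite /conjm /mmul /minv M1; case: i; case: j => /=; field.
- by apply: matP => i j; rewrite /conjm /mmul /minv M1; case: i; case: j => /=; field.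
by apply: matP => i j; rewrite /congr_form /minv M1; case: i; case: j => /=; field.
Qed.

Lemma sorbit_sym a L R B d : sorbit (alg a L R B) d -> sorbit d (alg a L R B).
Proof.
move=> /sorbit_algP[s [M [s0 M0 ->]]]; apply/sorbit_algP.
exists s^-1, (minv M); split; rewrite ?invr_eq0 ?mdet_minv ?invr_eq0 //.
congr alg; first by field.
- apply: matP => i j; rewrite -[LHS](conjmV L i j M0) /conjm /mmul; by field.
- apply: matP => i j; rewrite -[LHS](conjmV R i j M0) /conjm /mmul; by field.
apply: matP => i j; rewrite -[LHS](congr_formV B i j M0) /congr_form; by field.
Qed.

Lemma sorbit_trans a L R B d e : sorbit (alg a L R B) d -> sorbit d e -> sorbit (alg a L R B) e.
Proof.
move=> /sorbit_algP[s [M [s0 M0 ->]]] /sorbit_algP[t [N [t0 N0 ->]]]; apply/sorbit_algP.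
exists (t * s), (mmul N M); rewrite mdetM !mulf_neq0 //; split=> //.
congr alg; first by field; rewrite t0 s0.
- by apply: matP => i j; rewrite /conjm minv_mul // /mmul; field; rewrite t0 s0.
- by apply: matP => i j; rewrite /conjm minv_mul // /mmul; field; rewrite t0 s0.
by apply: matP => i j; rewrite /congr_form minv_mul // /mmul; ring.
Qed.

Lemma seteq_sym (T : Type) (A C : T -> Prop) : seteq A C -> seteq C A.
Proof. by move=> AC x; split=> /AC. Qed.

Lemma seteq_trans (T : Type) (A C D : T -> Prop) : seteq A C -> seteq C D -> seteq A D.
Proof. by move=> eqAC eqCD x; rewrite eqAC. Qed.

(** * The irreducible components *)

Lemma irreducible_sub_component W : irreducible W -> subset_of W AssocVar ->
  exists2 k, (k < 12)%N & subset_of W (component k).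
Proof.
move=> irrW WX; apply: irreducible_bigunion => // [i|c /WX]; first exact: zclosed_component.
exact: AssocVar_cover.
Qed.

Lemma irr_componentP W :
  irr_component AssocVar W <-> exists2 k, (k < 12)%N & seteq W (component k).
Proof.
split=> [[irrW WX maxW]|[k k12 Wk]].
  have [k k12 Wk] := irreducible_sub_component irrW WX.
  have kW := maxW _ (irreducible_component k) Wk (@component_AssocVar k).
  by exists k; last exact: seteq_sym kW.
split; first exact: irreducible_seteq (seteq_sym Wk) (irreducible_component k).
  by move=> c /Wk; apply: component_AssocVar.
move=> V irrV WV VX; have [l l12 Vl] := irreducible_sub_component irrV VX.
have kl : k = l by apply: component_subset => // c /Wk /WV /Vl.
by move=> c; split=> [/Vl|/WV //]; rewrite -kl => /Wk.
Qed.

Lemma comp_ofE (i : 'I_12) : seteq (comp_of i) (component i).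
Proof.
case: i => [[|[|j]] ji]; [exact: component_R04 | exact: component_R06 | rewrite /comp_of /=].
have j10 : (j < 10)%N by [].
rewrite -[X in nth _ X]/([seq orbit_cl c | c <- rigid_list]).
by rewrite (nth_map R09) // rigid_listE //; apply: component_base.
Qed.

(** * The dimension of the variety *)

Lemma has_chain_le (T : finType) (Y Y' : (T -> CC) -> Prop) m n :
  (m <= n)%N -> subset_of Y Y' -> has_chain Y n -> has_chain Y' m.
Proof.
move=> mn YY' [Z [Zirr ltZ]]; exists Z; split=> i le_im.
  by have [Zi ZY] := Zirr i (leq_trans le_im mn); split=> // x /ZY /YY'.
exact: ltZ (leq_trans le_im mn).
Qed.

(** The chain consists of coordinate subspaces: step [n] allows only the first [n] of the four
    entries of the form to be nonzero. *)
Lemma component0_chain : has_chain (component 0) 4.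
Proof.
pose pos (w : bool * bool) := (w.1.*2 + w.2)%N.
pose F n (t : param) := formalg (fun i j => if (pos (i, j) < n)%N then t (i, j) else 0).
have polyF n x : polyfun (fun t => F n t x).
  apply: polyfun_alg => [|i j|i j|i j]; try exact: polyfun_const.
  by case: (_ < n)%N; [apply: polyfun_coord | apply: polyfun_const].
exists (fun n => zclosure (image_of (F n))); split=> n n4.
  split; first exact: irreducible_image.
  apply: zclosure_sub => _ [t ->]; apply: sub_zclosure.
  by exists (fun w => if (pos w < n)%N then t w else 0).
split.
  apply: zclosure_sub => _ [t ->]; apply: sub_zclosure.
  exists (fun w => if (pos w < n)%N then t w else 0).
  rewrite /F; congr formalg; apply: matP => i j.
  by case: ifP => [/leqW -> //|_]; case: ifP.
have [w wn] : exists w, pos w = n.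
  case: n n4 => [|[|[|[|//]]]] _; [exists (false, false) | exists (false, true)
    | exists (true, false) | exists (true, true)] => //.
move=> /(_ (F n.+1 (fun=> 1))) H.
have : cB (F n.+1 (fun=> 1)) w.1 w.2 = 0.
  apply: (H _ (fun c => cB c w.1 w.2 = 0)); first by apply: sub_zclosure; exists (fun=> 1).
    exact/zclosed_zero/polyfun_cB.
  by move=> _ [t ->]; rewrite c_alg -surjective_pairing wn ltnn.
by rewrite c_alg -surjective_pairing wn leqnn => /eqP; rewrite oner_eq0.
Qed.

Lemma AssocVar_dim : variety_dim AssocVar 4.
Proof.
split.
  exists (component 0); split; first by apply/irr_componentP; exists 0%N.
  by split; [apply: component0_chain | apply: component_no_chain].
move=> Z m /irr_componentP[k _ Zk] [chZ _]; rewrite leqNgt; apply/negP => m5.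
by apply: (@component_no_chain k); apply: has_chain_le m5 _ chZ => c /Zk.
Qed.

(** * Rigid structures *)

Lemma cA_base p : cA (base p) = 1. Proof. exact: cA_alg. Qed.

Lemma AssocVar_base j : AssocVar (base (nth_ptype j)).
Proof. by apply: (@component_AssocVar j.+2); apply: base_component. Qed.

Lemma rigid_base j : (j < 10)%N -> rigid_in AssocVar (base (nth_ptype j)).
Proof.
move=> j10; split; first exact: AssocVar_base.
set p := nth_ptype j.
(* The closed complement of the orbit is a union over twelve indices. The index of the component
   itself carries the locus [a = 0], joined with [B = 0] when [pb p] holds; otherwise the second
   alternative repeats the first. *)
pose S k := if k == j.+2 then fun c => cA c = 0 \/
    (forall w : bool * bool, if pb p then cB c w.1 w.2 = 0 else cA c = 0) else component k.
have clS k : zclosed (S k).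
  rewrite /S; case: eqP => _; last exact: zclosed_component.
  apply: zclosed_union; first exact/zclosed_zero/polyfun_cA.
  apply: zclosed_inter => w; case: (pb p); apply: zclosed_zero; first exact: polyfun_cB.
  exact: polyfun_cA.
exists (fun c => exists2 k, (k < 12)%N & S k c); split; first exact: zclosed_bigunion.
move=> d; split.
  move=> /sorbit_base[u [v [a0 dE]]].
  have dj : component j.+2 d by rewrite dE; apply: palg_component => ->.
  have Ad : cA d = dot u v by rewrite dE c_alg.
  split; first exact: component_AssocVar dj.
  case=> k k12; rewrite /S; case: eqP => [_|kj] H.
    case: H => [|/(_ (_, _)) H]; first by rewrite Ad => /eqP; rewrite (negPf a0).
    case pE: (pb p) H => H; last by move: (H false false); rewrite Ad => /eqP; rewrite (negPf a0).
    have v0 i : v i = 0.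
      by have /eqP := H i i; rewrite dE c_alg pE mul1r mulf_eq0 orbb => /eqP.
    by move: a0; rewrite /dot !v0 !mulr0 addr0 eqxx.
  case: k k12 kj H => [|[|k]] k12 kj H.
  - by have /eqP := component_cA (k := 0%N) isT H; rewrite Ad (negPf a0).
  - by have /eqP := component_cA (k := 1%N) isT H; rewrite Ad (negPf a0).
  by apply: kj; congr _.+2; apply: component_meet H dj; rewrite // Ad.
move=> [/AssocVar_canonical[[B ->]|[s [t [v ->]]]|[i [b [u [v [i10 hb ->]]]]]] NS].
- by case: NS; exists 0%N => //; apply: sub_zclosure; exists (fun x => B x.1 x.2).
- case: NS; exists 1%N => //; apply: sub_zclosure.
  by exists (fun x => if x.1 then v x.2 else if x.2 then t else s).
have ij : i = j.
  apply: contrapT => ij; apply: NS; exists i.+2 => //; rewrite /S.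
  by case: eqP => [[]//|_]; apply: palg_component.
rewrite {}ij -/p in hb NS *.
have a0 : dot u v != 0.
  apply/eqP => a0; apply: NS; exists j.+2; rewrite // /S eqxx; left.
  by rewrite c_alg.
apply/sorbit_base; have [pT|/negbTE pF] := boolP (pb p); last by exists u, v; rewrite (hb pF).
have b0 : b != 0.
  apply/eqP => b0; apply: NS; exists j.+2; rewrite // /S eqxx; right => w.
  by rewrite pT c_alg b0 mul0r.
pose k := sqrtC b; have k0 : k != 0 by rewrite sqrtC_eq0.
exists (fun i => u i / k), (fun i => k * v i); split.
  by rewrite (_ : dot _ _ = dot u v) // /dot; field.
by rewrite -palg_rescale // mul1r sqrtCK.
Qed.

Lemma sorbit_base_inj i j : (i < 10)%N -> (j < 10)%N ->
  sorbit (base (nth_ptype i)) (base (nth_ptype j)) -> i = j.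
Proof.
move=> i10 j10 /sorbit_base[u [v [_ E]]].
apply: (@component_meet i j (base (nth_ptype j))) => //; first by rewrite cA_base oner_eq0.
  by rewrite E; apply: palg_component => ->.
exact: base_component.
Qed.

(** The complement [F] of the open orbit is closed; if the orbit missed [A], then [F] would contain
    the closure of [A], and so [c]. *)
Lemma rigid_meet c (A : struct -> Prop) : rigid_in AssocVar c ->
  subset_of A AssocVar -> zclosure A c -> exists d, A d /\ sorbit c d.
Proof.
move=> [Xc [F [clF orbF]]] AX Ac; apply: contrapT => H.
have [_ Fc] : AssocVar c /\ ~ F c.
  by apply/orbF; rewrite (evenE (proj1 Xc)); apply: sorbit_refl.
apply: Fc; apply: Ac => // d Ad; apply: contrapT => Fd.
by apply: H; exists d; split=> //; apply/orbF; split=> //; apply: AX.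
Qed.

(** The family is a line, so an open orbit containing [f x] contains [f y] for all but finitely many
    [y]. The polynomial [r] serves to avoid the parameters allowed by the isomorphism invariant. *)
Lemma rigid_family c (f : CC -> struct) (r : {poly CC}) x d :
    rigid_in AssocVar c -> (forall y, AssocVar (f y)) ->
    (forall y w, f y w = f 0 w + y * (f 1 w - f 0 w)) -> r != 0 ->
    sorbit c d -> sorbit (f x) d ->
  exists y, r.[y] != 0 /\ sorbit (f x) (f y).
Proof.
move=> [Xc [F [clF orbF]]] Xf f_affine r0 cd xd.
have cE := evenE (proj1 Xc); have fE y := evenE (proj1 (Xf y)).
have dx : sorbit d (f x) by move: xd; rewrite fE; apply: sorbit_sym.
have cx : sorbit c (f x) by move: cd; rewrite cE => cd; apply: sorbit_trans cd dx.
have xc : sorbit (f x) c by move: cx; rewrite cE; apply: sorbit_sym.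
have [_ Fx] := proj1 (orbF _) cx.
have [p [Fp px]] := zclosed_notin clF Fx.
pose g w : {poly CC} := (f 0 w)%:P + (f 1 w - f 0 w)%:P * 'X.
have gE y : (fun w => (g w).[y]) = f y.
  apply: funext => w; rewrite f_affine /g hornerD hornerM !hornerC hornerX; ring.
have [q Eq] := polyfun_curve g (polyfun_ev p).
have q0 : q != 0 by apply: contraNneq px => q0; rewrite -gE Eq q0 horner0.
have [y] := poly_nonroot (mulf_neq0 r0 q0).
rewrite hornerM mulf_eq0 negb_or -Eq gE => /andP[ry py]; exists y; split=> //.
have cy : sorbit c (f y).
  by apply/orbF; split=> // /Fp /eqP; rewrite (negPf py).
by move: xc; rewrite fE => xc; apply: sorbit_trans xc cy.
Qed.

Lemma base04_affine y w : base04 y w = base04 0 w + y * (base04 1 w - base04 0 w).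
Proof.
case: w => [[i j] k].
have [a ->] := bidxP i; have [b ->] := bidxP j; have [c ->] := bidxP k.
by rewrite /base04 /formalg !algE; case: a => [[]|]; case: b => [[]|]; case: c => [[]|] /=; ring.
Qed.

Lemma base06_affine y w : base06 y w = base06 0 w + y * (base06 1 w - base06 0 w).
Proof.
case: w => [[i j] k].
have [a ->] := bidxP i; have [b ->] := bidxP j; have [c ->] := bidxP k.
by rewrite /base06 !algE; case: a => [[]|]; case: b => [[]|]; case: c => [[]|] /=; ring.
Qed.

(** The orbit meets the dense union of listed orbits in its component. In a Peirce component the two
    orbits then coincide; in the two families the invariants give a contradiction. *)
Lemma rigid_is_base c : rigid_in AssocVar c ->
  exists2 j, (j < 10)%N & sorbit (base (nth_ptype j)) c.
Proof.
move=> rc; have [Xc _] := rc; have [k k12 kc] := AssocVar_cover Xc.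
case: k k12 kc => [|[|j]] k12 kc; last first.
- have [|d [bd cd]] := rigid_meet (A := sorbit (base (nth_ptype j))) rc _ (proj2 (component_base j c) kc).
    move=> d /sorbit_base[u [v [_ ->]]]; apply: assoc_palg; first exact: wf_nth_ptype.
    by move=> ->.
  exists j => //; apply: sorbit_trans bd _.
  by move: cd; rewrite (evenE (proj1 Xc)); apply: sorbit_sym.
- have Xf y : AssocVar (base06 y).
    rewrite -R06E; apply: (@component_AssocVar 1); apply/component_R06; apply: sub_zclosure; exists y.
    by rewrite R06E; apply: sorbit_refl.
  have [|d [[x]]] := rigid_meet (A := fun d => exists a, sorbit (R06 a) d) rc _
    (proj2 (component_R06 c) kc).
    by move=> d xd; apply: (@component_AssocVar 1); apply/component_R06; apply: sub_zclosure.
  rewrite R06E => xd cd.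
  have [|y [ry /sorbit_base06_inj xy]] :=
      rigid_family (r := 'X - x%:P) rc Xf base06_affine _ cd xd.
    by rewrite polyXsubC_eq0.
  by rewrite xy hornerXsubC subrr eqxx in ry.
have Xf y : AssocVar (base04 y) by apply: assoc_formalg.
have [|d [[x]]] := rigid_meet (A := fun d => exists a, sorbit (R04 a) d) rc _
    (proj2 (component_R04 c) kc).
  by move=> d xd; apply: (@component_AssocVar 0); apply/component_R04; apply: sub_zclosure.
rewrite R04E => xd cd.
(* The invariant of this family only sees [x ^+ 2], so both [x] and [- x] are excluded. *)
have [|y [ry /sorbit_base04_inv xy]] :=
    rigid_family (r := ('X - x%:P) * ('X + x%:P)) rc Xf base04_affine _ cd xd.
  by rewrite mulf_neq0 ?polyXsubC_eq0 // -[x%:P]opprK -polyCN polyXsubC_eq0.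
case/eqP: ry; rewrite hornerM hornerXsubC hornerD hornerX hornerC.
apply: (@mulfI _ 4%:R); first by rewrite pnatr_eq0.
by move: xy; rewrite /mdet /= => xy; apply: (eq_modulo (esym xy)); ring.
Qed.

Theorem mainTheorem9 :
  (* the variety has dimension 4 *)
  variety_dim AssocVar 4 /\
  (* its irreducible components are exactly the 12 listed, pairwise distinct, closures *)
  (forall i : 'I_12, irr_component AssocVar (comp_of i)) /\
  (forall Z, irr_component AssocVar Z -> exists i : 'I_12, seteq Z (comp_of i)) /\
  (forall i j : 'I_12, seteq (comp_of i) (comp_of j) -> i = j) /\
  (* exactly 10 rigid superalgebras, up to isomorphism *)
  (exists s : 'I_10 -> struct,
     (forall i, rigid_in AssocVar (s i)) /\
     (forall i j, sorbit (s i) (s j) -> i = j) /\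
     (forall c, rigid_in AssocVar c -> exists i, sorbit (s i) c)).
Proof.
split; first exact: AssocVar_dim.
split.
  by move=> i; apply/irr_componentP; exists (val i); [apply: ltn_ord | apply: comp_ofE].
split.
  move=> Z /irr_componentP[k k12 Zk]; exists (Ordinal k12).
  exact: seteq_trans Zk (seteq_sym (comp_ofE (Ordinal k12))).
split.
  move=> i j ij; apply: val_inj; apply: component_subset; try exact: ltn_ord.
  by move=> c /comp_ofE/ij/comp_ofE.
exists (fun i => base (nth_ptype i)); split; first by move=> i; apply/rigid_base/ltn_ord.
split; first by move=> i j ij; apply: val_inj; apply: sorbit_base_inj ij; apply: ltn_ord.
by move=> c /rigid_is_base[j j10 jc]; exists (Ordinal j10).
Qed.
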